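(* Let $\mathbb{G}$ be a Green kernel of type $(s,\gamma)$ on $\Omega$ with Green operator $\mathcal{G}$, and let $f\in L^1(\Omega,\delta^\gamma)$. a) If $\gamma>s-\frac12$, then $$\frac1\eta\int_{\{\delta<\eta\}}\frac{|\mathcal{G}(f)|}{\delta^{2s-\gamma-1}}\longrightarrow0\qquad\text{as }\eta\downarrow0.$$ b) If $\gamma=s-\frac12$, then $$\frac1{\eta\,|\ln\eta|}\int_{\{\delta<\eta\}}\frac{|\mathcal{G}(f)|}{\delta^{\gamma}}\longrightarrow0\qquad\text{as }\eta\downarrow0.$$ c) If $\gamma<s-\frac12$, then there is a constant $C$, independent of $\eta>0$, such that $$\frac1\eta\int_{\{\delta<\eta\}}\frac{|\mathcal{G}(f)|}{\delta^{\gamma}}\le C.$$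
   Context: $\Omega\subset\mathbb{R}^n$ ($n\ge1$) is a bounded domain with $C^{1,1}$ boundary and $\delta(x)=\mathrm{dist}(x,\partial\Omega)$; $\{\delta<\eta\}=\{x\in\Omega:\delta(x)<\eta\}$. Write $a\wedge b=\min\{a,b\}$. For nonnegative functions, $f\asymp g$ on a set means that there is a constant $C>0$ with $C^{-1}g\le f\le Cg$ on that set. $L^1(\Omega,\delta^\gamma)$ is the set of measurable $f$ on $\Omega$ with $f\delta^\gamma\in L^1(\Omega)$. A Green kernel of type $(s,\gamma)$ on $\Omega$, where $s,\gamma\in(0,1]$ and $2s\le n$, is a measurable function $\mathbb{G}:\Omega\times\Omega\to\mathbb{R}$ such that $\mathbb{G}(x,y)=\mathbb{G}(y,x)$ and $$\mathbb{G}(x,y)\asymp\frac{1}{|x-y|^{n-2s}}\Big(\frac{\delta(x)\delta(y)}{|x-y|^2}\wedge1\Big)^\gamma,\qquad x,y\in\Omega,\ x\ne y.$$ Its Green operator is $\mathcal{G}(f)(x)=\int_\Omega\mathbb{G}(x,y)f(y)\,dy$. *)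

(* Defs.v *)
From HB Require Import structures.
From mathcomp Require Import all_boot all_order all_algebra.
From mathcomp Require Import all_classical all_reals all_analysis.
Set Implicit Arguments.
Unset Strict Implicit.
Unset Printing Implicit Defensive.
Import Order.TTheory GRing.Theory Num.Theory.
Import numFieldNormedType.Exports.
Local Open Scope classical_set_scope.
Local Open Scope ring_scope.

(* R^n is 'rV[R]_n, with the library's topology.  The library norm of 'rV[R]_n
   is the sup norm; |x| in the mathematics is the Euclidean norm enorm below. *)

(* The Borel sigma-algebra of R^n, generated by the coordinates (the library
   does the same for n.-tuple). *)

Definition rV_display : measure_display.
Proof. exact: default_measure_display. Qed.

Section rV_measurable.
Context {R : realType} (n : nat).

Let coors : 'I_n -> 'rV[R]_n -> measurableTypeR R := fun i x => x ord0 i.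

Let rV_set0 : g_sigma_preimage coors set0.
Proof. exact: sigma_algebra0. Qed.

Let rV_setC A : g_sigma_preimage coors A -> g_sigma_preimage coors (~` A).
Proof. exact: sigma_algebraC. Qed.

Let rV_bigcup (F : (set 'rV[R]_n)^nat) :
  (forall i, g_sigma_preimage coors (F i)) ->
  g_sigma_preimage coors (\bigcup_i (F i)).
Proof. exact: sigma_algebra_bigcup. Qed.

HB.instance Definition _ := @isMeasurable.Build rV_display 'rV[R]_n
  (g_sigma_preimage coors) rV_set0 rV_setC rV_bigcup.

Lemma measurable_coord (i : 'I_n) :
  measurable_fun [set: 'rV[R]_n] (fun x => x ord0 i : measurableTypeR R).
Proof.
move=> _ Y mY; rewrite setTI; apply: sub_sigma_algebra => /=.
rewrite -bigcup_seq/=; exists i => /=; first by rewrite mem_index_enum.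
by exists Y => //; rewrite setTI.
Qed.

Lemma measurable_fun_coordP d (T : measurableType d) (f : T -> 'rV[R]_n) :
  (forall i, measurable_fun setT (fun t => f t ord0 i : measurableTypeR R)) ->
  measurable_fun setT f.
Proof.
move=> mf.
have H : g_sigma_preimage (fun i => coors i \o f) `<=` measurable.
  apply: smallest_sub; first exact: sigma_algebra_measurable.
  rewrite -bigcup_seq => A [i _ [B mB <-]]; exact: mf.
by rewrite g_sigma_preimage_comp in H => _ A mA; apply: H; exists A.
Qed.

End rV_measurable.

(* Lebesgue measure on R^n: the n-fold product of the Lebesgue measure of the
   line, transported along R * R^n ~ R^(n+1). *)

Definition row_cons {R : realType} n (p : measurableTypeR R * 'rV[R]_n) :
  'rV[R]_n.+1 := \row_i oapp (fun j => p.2 ord0 j) p.1 (unlift ord0 i).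

Lemma measurable_row_cons {R : realType} n :
  measurable_fun setT (@row_cons R n).
Proof.
apply: measurable_fun_coordP => i; rewrite /row_cons.
under eq_fun do rewrite mxE.
case: unliftP => [j _|_] /=; last exact: measurable_fst.
exact: (measurableT_comp (measurable_coord j) measurable_snd).
Qed.

Section rV_lebesgue_step.
Context {R : realType} (n : nat).
Variable mu : {sigma_finite_measure set 'rV[R]_n -> \bar R}.

Definition rV_lebesgue_step : set 'rV[R]_n.+1 -> \bar R :=
  pushforward (lebesgue_measure \x mu)%E (@row_cons R n).

HB.instance Definition _ := Measure.copy rV_lebesgue_step
  (measure_function_pushforward__canonical__measure_function_Measure
     (lebesgue_measure \x mu)%E (@measurable_row_cons R n)).

Let rV_lebesgue_step_sigma_finite : sigma_finite setT rV_lebesgue_step.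
Proof.
have [F FT mF] : sigma_finite setT (lebesgue_measure \x mu)%E.
  have /sigma_finiteP[F [TF ndF Foo]] := sigma_finiteT (@lebesgue_measure R).
  have /sigma_finiteP[G [TG ndG Goo]] := sigma_finiteT mu.
  exists (fun i => F i `*` G i).
    rewrite -setXTT TF TG predeqE => -[x y]; split.
      move=> [/= [i _ Fix] [j _ Gjy]]; exists (maxn i j) => //; split.
      - by move: x Fix; exact/subsetPset/ndF/leq_maxl.
      - by move: y Gjy; exact/subsetPset/ndG/leq_maxr.
    by move=> [i _ []/= ? ?]; split; exists i.
  move=> k; have [? ?] := Foo k; have [? ?] := Goo k.
  split; first exact: measurableX.
  by rewrite product_measure1E// lte_mul_pinfty// ge0_fin_numE.
pose u (x : 'rV[R]_n.+1) : measurableTypeR R * 'rV[R]_n :=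
  (x ord0 ord0, \row_j x ord0 (lift ord0 j)).
have mu_ : measurable_fun setT u.
  apply: measurable_fun_pair; first exact: measurable_coord.
  apply: measurable_fun_coordP => i.
  by under eq_fun do rewrite mxE; exact: measurable_coord.
have uK p : u (row_cons p) = p.
  case: p => a v; rewrite /u /row_cons mxE unlift_none/=; congr pair.
  by apply/rowP => j; rewrite !mxE liftK.
exists (fun i => u @^-1` F i).
  by rewrite -preimage_bigcup -FT preimage_setT.
move=> i; have [mFi Fi] := mF i; split.
  by rewrite -[X in measurable X]setTI; exact: mu_.
rewrite /rV_lebesgue_step /pushforward.
rewrite (_ : _ @^-1` _ = F i)//.
by apply/seteqP; split => p /=; rewrite uK.
Qed.

HB.instance Definition _ := Measure_isSigmaFinite.Build _ _ _
  rV_lebesgue_step rV_lebesgue_step_sigma_finite.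

End rV_lebesgue_step.

Fixpoint rV_lebesgue {R : realType} (n : nat) :
    {sigma_finite_measure set 'rV[R]_n -> \bar R} :=
  match n with
  | 0%N => \d_(0 : 'rV[R]_0)
  | m.+1 => rV_lebesgue_step (rV_lebesgue m)
  end.

Lemma measurable_box {R : realType} n (A : 'I_n -> set (measurableTypeR R)) :
  (forall i, measurable (A i)) ->
  measurable [set x : 'rV[R]_n | forall i, A i (x ord0 i)].
Proof.
move=> mA; rewrite [X in measurable X](_ : _ = \big[setI/setT]_(i < n)
    ((fun x : 'rV[R]_n => x ord0 i) @^-1` A i)).
  apply: bigsetI_measurable => i _; rewrite -[X in measurable X]setTI.
  exact: measurable_coord.
rewrite -bigcap_seq; apply/seteqP; split => x /= H i; first by move=> _; exact: H.
by apply: H; rewrite /= mem_index_enum.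
Qed.

Lemma rV_lebesgue_box {R : realType} n (A : 'I_n -> set (measurableTypeR R)) :
  (forall i, measurable (A i)) ->
  rV_lebesgue n [set x : 'rV[R]_n | forall i, A i (x ord0 i)] =
  (\prod_(i < n) lebesgue_measure (A i))%E.
Proof.
elim: n A => [|n IH] A mA /=.
  by rewrite big_ord0 diracE mem_set// => -[].
rewrite /rV_lebesgue_step /pushforward big_ord_recl.
rewrite [X in product_measure1 _ _ X](_ : _ = A ord0 `*`
    [set x : 'rV[R]_n | forall i, A (lift ord0 i) (x ord0 i)]).
  rewrite product_measure1E//; first by rewrite (IH (fun i => A (lift ord0 i))).
  exact: (@measurable_box R n (fun i => A (lift ord0 i))).
apply/seteqP; split => [[a v] /= H|[a v] [/= H0 H] i].
  split => [|i]; first by have := H ord0; rewrite mxE unlift_none.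
  by have := H (lift ord0 i); rewrite mxE liftK.
by rewrite mxE; case: unliftP => [j ->|->].
Qed.

(* Measurability with respect to the completion of mu (for the measures above,
   Lebesgue measurability): almost everywhere equal on D to a Borel function.
   The library integral of a nonnegative function is the supremum over the
   Borel simple functions below it, so it has the usual value on such f. *)
Definition ae_measurable_fun d (T : measurableType d) (R : realType)
    (mu : {measure set T -> \bar R}) (D : set T) (f : T -> R) : Prop :=
  exists g : T -> R, measurable_fun setT g /\
    {ae mu, forall x, D x -> f x = g x}.

Section euclidean.
Context {R : realType}.

Definition enorm n (x : 'rV[R]_n) : R := Num.sqrt (\sum_i x ord0 i ^+ 2).

Definition boundary n (A : set 'rV[R]_n) : set 'rV[R]_n :=
  closure A `\` interior A.

(* dist(x, boundary of Omega), for a nonempty boundary *)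
Definition bdist n (Omega : set 'rV[R]_n) (x : 'rV[R]_n) : R :=
  inf [set enorm (x - y) | y in boundary Omega].

Definition gradient n (phi : 'rV[R]_n -> R) (x : 'rV[R]_n) : 'rV[R]_n :=
  \row_i 'D_(delta_mx ord0 i) phi x.

Definition C11_fun n (phi : 'rV[R]_n -> R) : Prop :=
  (forall x, differentiable phi x) /\
  exists L : R, forall x y,
    enorm (gradient phi x - gradient phi y) <= L * enorm (x - y).

(* Near each boundary point p, and after an orthogonal change of coordinates
   z = x Q, Omega is the set lying above the graph of a C^{1,1} function of the
   coordinates of z other than the k-th one (col' k z). *)
Definition C11_boundary n (Omega : set 'rV[R]_n) : Prop :=
  forall p, boundary Omega p ->
  exists (r : R) (Q : 'M[R]_n) (k : 'I_n) (phi : 'rV[R]_n.-1 -> R),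
    [/\ 0 < r, Q *m Q^T = 1%:M, C11_fun phi &
        forall x, enorm (x - p) < r ->
          (Omega x <-> phi (col' k (x *m Q)) < (x *m Q) ord0 k)].

Definition bounded_C11_domain n (Omega : set 'rV[R]_n) : Prop :=
  [/\ open Omega, connected Omega, Omega !=set0, bounded_set Omega &
      C11_boundary Omega].

End euclidean.

Section green.
Context {R : realType} (n : nat) (Omega : set 'rV[R]_n).
Local Notation delta := (bdist Omega).
Local Notation mu := (@rV_lebesgue R n).

Definition asymp_on T (D : set T) (f g : T -> R) : Prop :=
  exists2 C : R, 0 < C & forall t, D t -> C^-1 * g t <= f t <= C * g t.

Definition green_profile (s gamma : R) (x y : 'rV[R]_n) : R :=
  (enorm (x - y) `^ (n%:R - 2 * s))^-1 *
  (Num.min (delta x * delta y / enorm (x - y) ^+ 2) 1) `^ gamma.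

(* Only the values of G on Omega x Omega matter. *)
Definition green_kernel (s gamma : R) (G : 'rV[R]_n -> 'rV[R]_n -> R) : Prop :=
  [/\ 0 < s <= 1, 0 < gamma <= 1, 2 * s <= n%:R &
   [/\ ae_measurable_fun (mu \x mu)%E (Omega `*` Omega) (fun z => G z.1 z.2),
       forall x y, Omega x -> Omega y -> G x y = G y x &
       asymp_on [set z | [/\ Omega z.1, Omega z.2 & z.1 != z.2]]
         (fun z => G z.1 z.2) (fun z => green_profile s gamma z.1 z.2)]].

(* Extended-real valued; finite for almost every x in the cases of interest. *)
Definition green_op (G : 'rV[R]_n -> 'rV[R]_n -> R) (f : 'rV[R]_n -> R)
    (x : 'rV[R]_n) : \bar R :=
  (\int[mu]_(y in Omega) (G x y * f y)%:E)%E.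

Definition weighted_L1 (gamma : R) (f : 'rV[R]_n -> R) : Prop :=
  ae_measurable_fun mu Omega f /\
  (\int[mu]_(x in Omega) (`|f x * delta x `^ gamma|)%:E < +oo)%E.

Definition bd_strip (eta : R) : set 'rV[R]_n :=
  Omega `&` [set x | delta x < eta].

(* the integral of |F| / delta^p over {delta < eta} *)
Definition strip_integral (p : R) (F : 'rV[R]_n -> \bar R) (eta : R) : \bar R :=
  (\int[mu]_(x in bd_strip eta) (`|F x| * ((delta x `^ p)^-1)%:E))%E.

End green.

(* Main.v *)
Require Import Defs.
From mathcomp Require Import all_boot all_order all_algebra.
From mathcomp Require Import all_classical all_reals all_analysis.
From mathcomp Require Import measurable_realfun ring lra.

(** Write [K_eta(y)] for the integral of [G(x, y) / delta(x)^p] over the strip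
    [delta(x) < eta]. By Tonelli the strip integral of [|G(f)|] is at most the
    integral of [|f| K_eta], so it suffices to prove [K_eta(y) <= C eta delta(y)^gamma]
    (with an extra [|ln eta|] in the critical case), which is already c). For a) and
    b), [K_eta(y)] is moreover [o(eta)], resp. [o(eta |ln eta|)], for each fixed [y],
    and dominated convergence gives the limits.

    The only geometric input is that the part of the strip of width [t] inside a
    ball of radius [r] has measure at most [A t r^(n-1)]. In a boundary chart this
    part lies in a layer of thickness [C t] above a Lipschitz graph, which is
    covered by [C (r / t)^(n-1)] sets of diameter [C t], each contained in an
    axis-parallel cube; so no rotation invariance of Lebesgue measure is needed.
    The bounds on [K_eta] follow by summing over dyadic shells around [y]. When
    [gamma > s - 1/2] and [|x - y| < eta] one separates [delta(x) <= 2 |x - y|],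
    where the kernel is of order [|x - y|^(1-n)], from [delta(x) > 2 |x - y|],
    where [delta(x)] and [delta(y)] are comparable.

    [G] and [f] need not be Borel, so they are first replaced by a Borel majorant:
    the library integral of a nonnegative function is a supremum over simple
    functions, hence monotone without any measurability. *)

Set Implicit Arguments.
Unset Strict Implicit.
Unset Printing Implicit Defensive.
Import Order.TTheory GRing.Theory Num.Theory.
Import numFieldNormedType.Exports.
Local Open Scope classical_set_scope.
Local Open Scope ring_scope.

(** * Measurability of strict sublevel and superlevel sets *)

Lemma measurable_lt_fun d (T : measurableType d) (R : realType) (h : T -> R) (t : R) :
  measurable_fun setT h -> measurable [set x | h x < t].
Proof.
move=> mh; rewrite (_ : [set x | h x < t] = setT `&` h @^-1` `]-oo, t[%classic).
  by apply: mh => //; exact: measurable_itv.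
by rewrite setTI; apply/seteqP; split => x /=; rewrite in_itv/=.
Qed.

Lemma measurable_gt_fun d (T : measurableType d) (R : realType) (h : T -> R) (t : R) :
  measurable_fun setT h -> measurable [set x | t < h x].
Proof.
move=> mh; rewrite (_ : [set x | t < h x] = setT `&` h @^-1` `]t, +oo[%classic).
  by apply: mh => //; exact: measurable_itv.
by rewrite setTI; apply/seteqP; split => x /=; rewrite in_itv/= andbT.
Qed.

(** * Euclidean norm and Borel sets of R^n *)

Section enorm.
Context {R : realType} {n : nat}.
Implicit Types (x y z : 'rV[R]_n).

Lemma enorm_ge0 x : 0 <= enorm x.
Proof. exact: sqrtr_ge0. Qed.

Lemma sqr_enorm x : enorm x ^+ 2 = \sum_i x ord0 i ^+ 2.
Proof. by rewrite /enorm sqr_sqrtr// sumr_ge0// => i _; exact: sqr_ge0. Qed.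

Lemma enorm0 : enorm (0 : 'rV[R]_n) = 0.
Proof. by rewrite /enorm big1 ?sqrtr0// => i _; rewrite mxE expr0n. Qed.

Lemma enormN x : enorm (- x) = enorm x.
Proof. by rewrite /enorm; congr Num.sqrt; apply: eq_bigr => i _; rewrite mxE sqrrN. Qed.

Lemma enormB x y : enorm (x - y) = enorm (y - x).
Proof. by rewrite -opprB enormN. Qed.

Lemma coord_le_enorm x i : `|x ord0 i| <= enorm x.
Proof.
rewrite -[leRHS]ger0_norm ?enorm_ge0// -ler_sqr ?nnegrE ?normr_ge0//.
rewrite !real_normK ?num_real// sqr_enorm (bigD1 i)//= lerDl.
by rewrite sumr_ge0// => j _; exact: sqr_ge0.
Qed.

(** The crude factor [n] in place of its square root is harmless, since every later estimate is up
    to a constant. *)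
Lemma enorm_le x r : 0 <= r -> (forall i, `|x ord0 i| <= r) ->
  enorm x <= n%:R * r.
Proof.
move=> r0 xr; rewrite -ler_sqr ?nnegrE ?enorm_ge0 ?mulr_ge0// sqr_enorm.
apply: (@le_trans _ _ (\sum_(i < n) r ^+ 2)).
  by apply: ler_sum => i _; rewrite -real_normK ?num_real// lerXn2r ?nnegrE.
rewrite sumr_const card_ord exprMn -[leLHS]mulr_natl ler_wpM2r ?sqr_ge0//.
by rewrite -natrX ler_nat; case: (n) => // m; rewrite leq_pmulr.
Qed.

Lemma cauchy_schwarz (a b : 'I_n -> R) :
  (\sum_i a i * b i) ^+ 2 <= (\sum_i a i ^+ 2) * (\sum_i b i ^+ 2).
Proof.
set P := \sum_i a i * b i; set A := \sum_i a i ^+ 2; set B := \sum_i b i ^+ 2.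
have B0 : 0 <= B by rewrite sumr_ge0// => i _; exact: sqr_ge0.
have [Bp|Bn] := ltrP 0 B; last first.
  have Bz : B = 0 by apply/eqP; rewrite eq_le Bn.
  suff -> : P = 0 by rewrite expr0n/= Bz mulr0.
  rewrite /P big1// => i _; move: Bz => /eqP; rewrite psumr_eq0; last first.
    by move=> j _; exact: sqr_ge0.
  by move=> /allP/(_ i (mem_index_enum _)); rewrite sqrf_eq0 => /eqP->; rewrite mulr0.
(* This sum expands to [B * (A * B - P ^+ 2)], and the positive factor [B] can be cancelled. *)
have : 0 <= \sum_i (B * a i - P * b i) ^+ 2.
  by rewrite sumr_ge0// => i _; exact: sqr_ge0.
suff -> : \sum_i (B * a i - P * b i) ^+ 2 = B * (A * B - P ^+ 2).
  by rewrite pmulr_rge0// subr_ge0.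
rewrite (eq_bigr (fun i => B ^+ 2 * a i ^+ 2 +
  (- (2 * (B * P)) * (a i * b i) + P ^+ 2 * b i ^+ 2))); last first.
  by move=> i _; ring.
rewrite !big_split/= -!mulr_sumr -/A -/B -/P; ring.
Qed.

Lemma enormD x y : enorm (x + y) <= enorm x + enorm y.
Proof.
rewrite -ler_sqr ?nnegrE ?enorm_ge0 ?addr_ge0 ?enorm_ge0// sqr_enorm.
under eq_bigr => i _ do rewrite mxE sqrrD.
rewrite !big_split/= -!sqr_enorm sqrrD lerD2r lerD2l.
rewrite -mulr2n lerMn2r/=.
rewrite (le_trans (ler_norm _))// -ler_sqr ?nnegrE ?mulr_ge0 ?enorm_ge0//.
by rewrite real_normK ?num_real// exprMn !sqr_enorm cauchy_schwarz.
Qed.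

Lemma enorm_triangle x y z : enorm (x - z) <= enorm (x - y) + enorm (y - z).
Proof. by rewrite (le_trans _ (enormD _ _))// subrKA. Qed.

Lemma enorm_gt0 x : x != 0 -> 0 < enorm x.
Proof.
apply: contra_neqT; rewrite -leNgt => x0; apply/rowP => i; rewrite mxE.
by apply/eqP; rewrite -normr_le0 (le_trans (coord_le_enorm _ _)).
Qed.

Lemma enorm_orthogonal (Q : 'M[R]_n) x : Q *m Q^T = 1%:M ->
  enorm (x *m Q) = enorm x.
Proof.
move=> QQ.
have E (v : 'rV[R]_n) : \sum_i v ord0 i ^+ 2 = (v *m v^T) ord0 ord0.
  by rewrite mxE; apply: eq_bigr => i _; rewrite mxE expr2.
by rewrite /enorm !E trmx_mul mulmxA -(mulmxA x) QQ mulmx1.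
Qed.

End enorm.

Lemma enorm_col' {R : realType} n (k : 'I_n.+1) (x : 'rV[R]_n.+1) :
  enorm (col' k x) <= enorm x.
Proof.
rewrite -ler_sqr ?nnegrE ?enorm_ge0// !sqr_enorm.
rewrite [leRHS](bigD1_ord k)//= (eq_bigr (fun i => x ord0 (lift k i) ^+ 2)).
  by rewrite lerDr sqr_ge0.
by move=> i _; rewrite mxE.
Qed.

Lemma enorm_le_col' {R : realType} n (k : 'I_n.+1) (x : 'rV[R]_n.+1) :
  enorm x <= `|x ord0 k| + enorm (col' k x).
Proof.
rewrite -ler_sqr ?nnegrE ?enorm_ge0 ?addr_ge0 ?enorm_ge0// sqrrD !sqr_enorm.
rewrite (bigD1_ord k)//= real_normK ?num_real//.
rewrite (eq_bigr (fun i => col' k x ord0 i ^+ 2)); last by move=> i _; rewrite mxE.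
by rewrite -addrA lerD2l lerDr mulrn_wge0// mulr_ge0// enorm_ge0.
Qed.

Section topology.
Context {R : realType} {n : nat}.
Implicit Types (x y z : 'rV[R]_n) (A U : set 'rV[R]_n).

(** The topology comes from the sup norm, and the two norms differ by a factor of at most [n]. The
    radius is divided by [n.+1] so that the final inequality is strict and the divisor is nonzero
    also for [n = 0]. *)
Lemma open_enormP U : open U <->
  forall x, U x -> exists2 r, 0 < r & forall y, enorm (x - y) < r -> U y.
Proof.
split=> [oU x Ux|H].
  have /nbhs_ballP [r /= r0 rU] : nbhs x U by exact: open_nbhs_nbhs.
  exists r => // y xy; apply: rU; split => // i j.
  rewrite (ord1 i) /ball/= (le_lt_trans _ xy)//.
  by have := coord_le_enorm (x - y) j; rewrite !mxE.
rewrite openE => x /H[r r0 rU]; apply/nbhs_ballP.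
exists (r / n.+1%:R) => /=; first by rewrite divr_gt0.
move=> y [_ xy]; apply: rU.
apply: (@le_lt_trans _ _ (n%:R * (r / n.+1%:R))).
  apply: enorm_le => [|i]; first by rewrite divr_ge0// ltW.
  by have /ltW := xy ord0 i; rewrite /= !mxE.
by rewrite mulrCA gtr_pMr// ltr_pdivrMr// mul1r ltr_nat.
Qed.

Lemma closure_enormP A x : closure A x <->
  forall r, 0 < r -> exists2 y, A y & enorm (x - y) < r.
Proof.
split=> [Ax r r0|H B].
  have oB : open [set y | enorm (x - y) < r].
    apply/open_enormP => y /= xy; exists (r - enorm (x - y)); first lra.
    by move=> z yz; have := enorm_triangle x y z; lra.
  have /Ax[y [Ay xy]] : nbhs x [set y | enorm (x - y) < r].
    by apply: open_nbhs_nbhs; split => //=; rewrite subrr enorm0.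
  by exists y.
rewrite nbhsE => -[U [oU Ux] UB].
have /open_enormP/(_ _ Ux)[r r0 rU] := oU.
by have [y Ay xy] := H _ r0; exists y; split => //; exact/UB/rU.
Qed.

Lemma bounded_enormP A : bounded_set A ->
  exists2 M, 0 < M & forall x, A x -> enorm x < M.
Proof.
move=> [M [_ HM]]; pose K := `|M| + 1.
have K0 : 0 < K by rewrite ltr_wpDl.
have MK : M < K by rewrite ltr_pwDr// ler_norm.
exists (n%:R * K + 1); first by rewrite ltr_wpDl// mulr_ge0// ltW.
move=> x Ax; rewrite ltr_pwDr//; apply: enorm_le => [|i]; first exact: ltW.
apply: le_trans (HM _ MK _ Ax).
rewrite [leRHS]/Num.norm/= mx_normrE.
by apply/bigmax_geP; right => /=; exists (ord0, i).
Qed.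

Lemma measurable_enorm d (T : measurableType d) (f g : T -> 'rV[R]_n) :
  measurable_fun setT f -> measurable_fun setT g ->
  measurable_fun setT (fun t => enorm (f t - g t)).
Proof.
move=> mf mg; apply: (measurableT_comp (f := @Num.sqrt R)).
  by apply: continuous_measurable_fun; exact: sqrt_continuous.
apply: measurable_sum => i.
apply: measurable_funX.
under eq_fun do rewrite !mxE.
apply: measurable_funB; exact: (measurableT_comp (measurable_coord i)).
Qed.

(** The sigma-algebra is generated by the coordinates, so an open set has to be exhibited as a
    countable union of measurable sets: the balls with rational centre and radius [1 / (k + 1)] that
    it contains. *)
Lemma open_measurable_rV U : open U -> measurable U.
Proof.
move=> /open_enormP oU.
pose q (a : 'rV[rat]_n) : 'rV[R]_n := map_mx ratr a.
pose B (p : 'rV[rat]_n * nat) := [set x | enorm (q p.1 - x) < p.2.+1%:R^-1].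
pose D := [set p | B p `<=` U].
have mB p : measurable (B p).
  rewrite -[X in measurable X]setTI (_ : B p =
    (fun x => enorm (q p.1 - x)) @^-1` `]-oo, p.2.+1%:R^-1[%classic).
    by apply: (measurable_enorm (f := cst (q p.1)) (g := id)).
  by apply/seteqP; split => x /=; rewrite in_itv/=.
suff -> : U = \bigcup_p (if pselect (D p) then B p else set0).
  apply: countable_bigcupT_measurable => [|p]; last first.
    by case: pselect => ? /=; [exact: mB|exact: measurable0].
  exact: countableP.
apply/seteqP; split => [x Ux|x [p _]]; last by case: pselect => // Dp; exact: Dp.
have [r r0 rU] := oU _ Ux.
(* With this [k] twice the radius [1 / (k + 1)] is below [r], so a ball of that radius which
   contains [x] stays in the [r]-ball around [x]. *)
pose k := Num.trunc (2 / r).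
have k0 : 0 < k.+1%:R^-1 :> R by rewrite invr_gt0.
have kr : k.+1%:R^-1 * 2 < r.
  by rewrite mulrC -ltr_pdivlMr ?invr_gt0// invrK mulrC -ltr_pdivrMr// truncnS_gt.
have k1 : 0 < k.+1%:R^-1 / (n.+1%:R : R) by rewrite divr_gt0.
have H i : {a : rat | `|ratr a - x ord0 i| < k.+1%:R^-1 / n.+1%:R}.
  apply: cid.
  have [|a] := @rat_in_itvoo R (x ord0 i) (x ord0 i + k.+1%:R^-1 / n.+1%:R).
    by rewrite ltrDl.
  rewrite in_itv/= => /andP[xa ax]; by exists a; rewrite gtr0_norm ?subr_gt0// ltrBlDl.
pose a : 'rV[rat]_n := \row_i sval (H i).
have ax : enorm (q a - x) < k.+1%:R^-1.
  apply: (@le_lt_trans _ _ (n%:R * (k.+1%:R^-1 / n.+1%:R))).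
    apply: enorm_le => [|i]; first exact: ltW.
    by rewrite /q !mxE ltW//; exact: (svalP (H i)).
  by rewrite mulrCA gtr_pMr// ltr_pdivrMr// mul1r ltr_nat.
exists (a, k) => //; case: pselect => // -[]; rewrite /D /B /= => y /= ay.
apply: rU; have := enorm_triangle x (q a) y; rewrite (enormB x (q a)).
move: ay ax kr => /=; move: (k.+1%:R^-1) => e; lra.
Qed.

Lemma measurable_fun_lipschitz (h : 'rV[R]_n -> R) :
  (forall x y, h x <= h y + enorm (x - y)) -> measurable_fun setT h.
Proof.
move=> hl; move=> mD; apply: (measurability _ (RGenInftyO.measurableE R)) => //.
move=> /= _ [_ [t ->] <-]; rewrite setTI; apply: open_measurable_rV; apply/open_enormP => x.
rewrite /= in_itv/= => xt; exists (t - h x); first by rewrite subr_gt0.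
by move=> y xy; rewrite in_itv/=; have := hl y x; rewrite enormB; lra.
Qed.

End topology.

(** * C^{1,1} graphs and coverings by cells *)

Section gradient.
Context {R : realType} {m : nat}.
Implicit Types (phi : 'rV[R]_m -> R) (a b v : 'rV[R]_m).

Lemma derive_gradient phi a v : differentiable phi a ->
  'D_v phi a = \sum_i v ord0 i * gradient phi a ord0 i.
Proof.
move=> dphi; rewrite deriveE// {1}(row_sum_delta v) linear_sum/=.
by apply: eq_bigr => i _; rewrite linearZ/= mxE deriveE.
Qed.

Lemma is_derive_line phi a v (t : R) : differentiable phi (a + t *: v) ->
  is_derive t 1 (fun u : R => phi (a + u *: v)) ('D_v phi (a + t *: v)).
Proof.
move=> dphi.
have E : (fun h : R => h^-1 *: (phi (a + (h *: (1 : R) + t) *: v) - phi (a + t *: v))) =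
    (fun h : R => h^-1 *: (phi (h *: v + (a + t *: v)) - phi (a + t *: v))).
  by apply/funext => h; rewrite [h%:A]mulr1 scalerDl addrCA.
split; last by rewrite /derive E.
rewrite /derivable E; exact: (@diff_derivable _ _ _ _ _ v dphi).
Qed.

(** The one-dimensional mean value theorem along the segment gives a directional derivative, which
    Cauchy-Schwarz bounds by the gradient. *)
Lemma gradient_mean_value phi (M : R) a b :
  (forall x, differentiable phi x) -> 0 <= M ->
  (forall t, 0 <= t <= 1 -> enorm (gradient phi (a + t *: (b - a))) <= M) ->
  phi b - phi a <= M * enorm (b - a).
Proof.
move=> dphi M0 gM; set v := b - a.
have [|||c] := @MVT_segment R (fun u : R => phi (a + u *: v))
    (fun t => 'D_v phi (a + t *: v)) 0 1.
- by [].
- by move=> x _; exact: is_derive_line.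
- apply: continuous_subspaceT => x; apply/differentiable_continuous/derivable1_diffP.
  by have [] := is_derive_line (dphi (a + x *: v)).
rewrite in_itv/= scale0r addr0 scale1r subr0 mulr1 /v subrKC => c01 ->.
rewrite derive_gradient//.
apply: (@le_trans _ _ (enorm (gradient phi (a + c *: v)) * enorm v)); last first.
  by rewrite ler_wpM2r ?enorm_ge0 ?gM.
rewrite (le_trans (ler_norm _))// -ler_sqr ?nnegrE ?mulr_ge0 ?enorm_ge0//.
by rewrite real_normK ?num_real// exprMn !sqr_enorm mulrC cauchy_schwarz.
Qed.

(** On the ball the Lipschitz gradient is at most its norm at the centre plus [|L| * r]. The ball is
    convex, so this bound holds along the whole segment from [y] to [x]. *)
Lemma C11_fun_lipschitz phi a (r : R) : C11_fun phi -> 0 < r ->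
  exists2 M, 0 <= M & forall x y, enorm (x - a) < r -> enorm (y - a) < r ->
    phi x - phi y <= M * enorm (x - y).
Proof.
move=> [dphi [L HL]] r0; pose M := enorm (gradient phi a) + `|L| * r.
have M0 : 0 <= M by rewrite addr_ge0 ?enorm_ge0// mulr_ge0// ltW.
exists M => // x y xa ya; apply: gradient_mean_value => // t /andP[t0 t1].
set z := y + _.
have za : enorm (z - a) <= r.
  rewrite (_ : z - a = t *: (x - a) + (1 - t) *: (y - a)); last first.
    by apply/rowP => i; rewrite !mxE; ring.
  have enormZ (c : R) (u : 'rV[R]_m) : 0 <= c -> enorm (c *: u) = c * enorm u.
    move=> c0; rewrite /enorm; under eq_bigr do rewrite mxE exprMn.
    by rewrite -mulr_sumr sqrtrM ?sqr_ge0// sqrtr_sqr ger0_norm.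
  rewrite (le_trans (enormD _ _))// !enormZ ?subr_ge0//; nra.
have := enorm_triangle (gradient phi z) (gradient phi a) 0.
rewrite !subr0 => /le_trans; apply; rewrite addrC lerD2l (le_trans (HL _ _))//.
apply: (@le_trans _ _ (`|L| * enorm (z - a))).
  by rewrite ler_wpM2r ?enorm_ge0 ?ler_norm.
by rewrite ler_wpM2l.
Qed.

End gradient.

Section covering.
Context {R : realType}.
Local Notation mu n := (@rV_lebesgue R n).

Let cubeE n (x : 'rV[R]_n) (h : R) :
  [set y : 'rV[R]_n | forall i, `|x ord0 i - y ord0 i| <= h] =
  [set y | forall i, `[x ord0 i - h, x ord0 i + h]%classic (y ord0 i)].
Proof.
apply/seteqP; split => y /= H i; have := H i; rewrite /= in_itv/= ler_norml;
  move=> /andP[? ?]; apply/andP; split; lra.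
Qed.

Lemma rV_lebesgue_cube n (x : 'rV[R]_n) (h : R) : 0 <= h ->
  mu n [set y | forall i, `|x ord0 i - y ord0 i| <= h] = ((2 * h) ^+ n)%:E.
Proof.
move=> h0; rewrite (congr1 (mu n) (cubeE x h)).
rewrite (rV_lebesgue_box (A := fun i => `[x ord0 i - h, x ord0 i + h]%classic)); last first.
  by move=> i; exact: measurable_itv.
rewrite (eq_bigr (fun=> (2 * h)%:E)); last first.
  move=> i _; rewrite lebesgue_measure_itv/= lte_fin.
  case: ltP => [_|]; first by rewrite -EFinB; congr EFin; ring.
  by move=> H; congr EFin; lra.
by rewrite prodEFin prodr_const card_ord.
Qed.

Lemma measurable_cube n (x : 'rV[R]_n) (h : R) :
  measurable [set y : 'rV[R]_n | forall i, `|x ord0 i - y ord0 i| <= h].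
Proof. by rewrite (cubeE x h);
  apply: (measurable_box (A := fun i => `[x ord0 i - h, x ord0 i + h]%classic)). Qed.

Lemma finite_cover_measure d (T : measurableType d) (nu : {measure set T -> \bar R})
    (I : finType) (S : set T) (B : I -> set T) (v : R) :
  measurable S -> (forall i, measurable (B i)) ->
  S `<=` \bigcup_i B i -> (forall i, (nu (B i) <= v%:E)%E) ->
  (nu S <= (#|I|%:R * v)%:E)%E.
Proof.
move=> mS mB SB Bv.
have [I0|I0] := posnP #|I|.
  rewrite (_ : S = set0) ?measure0 ?I0 ?mul0r//.
  apply/seteqP; split => // x /SB[i _ _].
  by have := fintype0 i; rewrite I0.
have [i0 _] : exists i0 : I, true by case/card_gt0P : I0 => i _; exists i.
pose B' k := B (nth i0 (enum I) k).
have /le_trans -> // : (nu S <= \sum_(k < #|I|) nu (B' k))%E.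
  apply: content_subadditive => // [k _|x /SB[i _ Bi]]; first exact: mB.
  rewrite -bigcup_mkord; exists (index i (enum I)).
    by rewrite /= cardE index_mem mem_enum.
  by rewrite /B' nth_index// mem_enum.
apply: (@le_trans _ _ (\sum_(k < #|I|) v%:E)%E).
  by apply: lee_sum => k _; exact: Bv.
by rewrite sumEFin sumr_const card_ord mulr_natl.
Qed.

(* Sorting [S] by the integer parts of the [m] coordinates [c / t] gives at most
   [(3 r / t)^m] cells, each inside a cube of side [2 K t]. *)
Lemma measure_cells m n (S : set 'rV[R]_n) (c : 'rV[R]_n -> 'I_m -> R)
    (c0 : 'I_m -> R) (r t K : R) :
  measurable S -> 0 < t -> t <= r -> 0 <= K ->
  (forall x i, S x -> `|c x i - c0 i| < r) ->
  (forall x y, S x -> S y -> (forall i, `|c x i - c y i| < t) ->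
     forall j, `|x ord0 j - y ord0 j| <= K * t) ->
  (mu n S <= ((3 * r / t) ^+ m * (2 * (K * t)) ^+ n)%:E)%E.
Proof.
move=> mS t0 tr K0 cr cK.
pose N := (Num.trunc (2 * r / t)).+1.
(* The shift by [r] makes the scaled coordinate nonnegative, where [Num.trunc] is the floor. *)
pose w x i := (c x i - c0 i + r) / t.
have w0 x i : S x -> 0 <= w x i.
  by move=> /(cr x i); rewrite ltr_norml => /andP[? ?]; rewrite divr_ge0 ?ltW//; lra.
have wN x i : S x -> (Num.trunc (w x i) < N)%N.
  move=> Sx; rewrite /N ltnS le_truncn// ler_pM2r ?invr_gt0//.
  by move: (cr x i Sx); rewrite ltr_norml => /andP[? ?]; lra.
pose cell (a : {ffun 'I_m -> 'I_N}) x := S x /\ forall i, Num.trunc (w x i) = a i.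
(* The cube covering a nonempty cell is centred at an arbitrarily chosen point of that cell; empty
   cells are covered by the empty set. *)
pose B a : set 'rV[R]_n := if pselect (exists x, cell a x) is left H then
  [set y | forall i, `|sval (cid H) ord0 i - y ord0 i| <= K * t] else set0.
(* The number of values per coordinate is at most [2 * r / t + 1], and [t <= r] absorbs the [1]. *)
have NE : N%:R <= 3 * r / t.
  rewrite /N -addn1 natrD.
  have : (Num.trunc (2 * r / t))%:R <= 2 * r / t.
    by rewrite truncn_le divr_ge0 ?ltW// mulr_gt0//; lra.
  have : 1 <= r / t by rewrite ler_pdivlMr// mul1r.
  by rewrite -!mulrA; lra.
apply: (@le_trans _ _ (#|{ffun 'I_m -> 'I_N}|%:R * (2 * (K * t)) ^+ n)%:E).
  apply: (@finite_cover_measure _ _ (mu n) _ S B) => //.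
  - rewrite /B => a; case: pselect => [H|_] /=; [exact: measurable_cube|exact: measurable0].
  - move=> x Sx; pose a := [ffun i => Ordinal (wN x i Sx)].
    have ax : cell a x by split => // i; rewrite ffunE.
    exists a => //; rewrite /B; case: pselect => [H|[]]; last by exists x.
    case: (cid H) => y [Sy yE] /= j; apply: cK => // i.
    have := yE i; rewrite ffunE /= => E.
    have /andP := truncn_itv (w0 _ i Sx); have /andP := truncn_itv (w0 _ i Sy).
    rewrite E; move: (Num.trunc _) => k; rewrite -natr1.
    rewrite /w !ler_pdivlMr// !ltr_pdivrMr// !mulrDl mul1r => -[? ?] [? ?].
    by rewrite ltr_norml; apply/andP; split; lra.
  - rewrite /B => a; case: pselect => [H|_] /=; last first.
      by rewrite measure0 lee_fin exprn_ge0// mulr_ge0// mulr_ge0// ltW.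
    by rewrite rV_lebesgue_cube// mulr_ge0// ltW.
rewrite card_ffun !card_ord lee_fin natrX ler_wpM2r//.
  by rewrite exprn_ge0// mulr_ge0// mulr_ge0// ltW.
have E0 : 0 <= 3 * r / t by apply: le_trans NE.
by apply: lerXn2r; rewrite ?nnegrE.
Qed.

Lemma measure_ball_le n (S : set 'rV[R]_n) (y : 'rV[R]_n) (r : R) :
  measurable S -> 0 <= r -> (forall x, S x -> enorm (x - y) < r) ->
  (mu n S <= ((2 * r) ^+ n)%:E)%E.
Proof.
move=> mS r0 Sr; rewrite -(rV_lebesgue_cube y r0).
apply: le_measure; rewrite ?inE//; first exact: measurable_cube.
move=> x /Sr xy i /=; rewrite distrC (le_trans _ (ltW xy))//.
by have := coord_le_enorm (x - y) i; rewrite !mxE.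
Qed.

End covering.

(** * Volume of boundary strips *)

Section boundary_distance.
Context {R : realType} {n : nat} (Omega : set 'rV[R]_n).
Implicit Types (x y q : 'rV[R]_n).

(** On the line through a point of [Omega] in the first coordinate direction, the parameters that
    lie in [Omega] are bounded. Their supremum gives a limit of points of [Omega] that is not
    interior, because an interior point would allow a larger parameter. *)
Lemma boundary_nonempty : (0 < n)%N -> open Omega -> Omega !=set0 ->
  bounded_set Omega -> boundary Omega !=set0.
Proof.
move=> n0 oO [x Ox] /bounded_enormP[M M0 OM].
have /open_enormP rO := oO.
pose e : 'rV[R]_n := delta_mx ord0 (Ordinal n0).
have enorm_e (c : R) : enorm (c *: e) = `|c|.
  rewrite /enorm (bigD1 (Ordinal n0))//= big1 => [|i i0].
    by rewrite !mxE !eqxx mulr1 addr0 sqrtr_sqr.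
  by rewrite !mxE (negbTE i0) andbF mulr0 expr0n.
pose S := [set t : R | Omega (x + t *: e)].
have S0 : S 0 by rewrite /S/= scale0r addr0.
have S_sup : has_sup S.
  split; first by exists 0.
  exists (M + M) => t /OM xt.
  rewrite (le_trans (ler_norm _))// -enorm_e.
  have := enorm_triangle (x + t *: e) 0 x; rewrite addrC addKr sub0r enormN subr0.
  by have := OM _ Ox; lra.
exists (x + sup S *: e); split.
  apply/closure_enormP => r r0; have [t St tS] := sup_adherent r0 S_sup.
  exists (x + t *: e) => //.
  rewrite opprD addrACA subrr add0r -scalerBl enorm_e ger0_norm; first lra.
  by rewrite subr_ge0; exact: sup_upper_bound.
move/interior_subset => /rO[r r0] /(_ (x + (sup S + r / 2) *: e)).
rewrite opprD addrACA subrr add0r -scalerBl enorm_e opprD addrA subrr add0r normrN.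
rewrite ger0_norm; last lra.
have r2 : r / 2 < r by lra.
move=> /(_ r2) /(sup_upper_bound S_sup); lra.
Qed.

Lemma domain_boundary_nonempty : (0 < n)%N -> bounded_C11_domain Omega ->
  boundary Omega !=set0.
Proof. by move=> n0 [? ? ? ? _]; exact: boundary_nonempty. Qed.

Hypothesis bO : boundary Omega !=set0.

Let inf_ok x : has_inf [set enorm (x - y) | y in boundary Omega].
Proof.
split; first by have [q bq] := bO; exists (enorm (x - q)), q.
by exists 0 => _ [q _ <-]; exact: enorm_ge0.
Qed.

Lemma bdist_ge0 x : 0 <= bdist Omega x.
Proof.
apply: lb_le_inf; first by have [] := inf_ok x.
by move=> _ [q _ <-]; exact: enorm_ge0.
Qed.

Lemma bdist_le x q : boundary Omega q -> bdist Omega x <= enorm (x - q).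
Proof. by move=> bq; apply: ge_inf; [have [] := inf_ok x|exists q]. Qed.

Lemma bdist_adherent x t : bdist Omega x < t ->
  exists2 q, boundary Omega q & enorm (x - q) < t.
Proof.
rewrite -subr_gt0 => /(inf_adherent)/(_ (inf_ok x))[_ [q bq <-]].
by rewrite -/(bdist Omega x) subrKC => xq; exists q.
Qed.

Lemma bdist_lipschitz x y : bdist Omega x <= bdist Omega y + enorm (x - y).
Proof.
apply/ler_addgt0Pr => e e0.
have [|q bq yq] := @bdist_adherent y (bdist Omega y + e); first by rewrite ltrDl.
by have := bdist_le x bq; have := enorm_triangle x y q; lra.
Qed.

Lemma bdist_gt0 x : open Omega -> Omega x -> 0 < bdist Omega x.
Proof.
move=> oO Ox; rewrite ltNge; apply/negP => d0.
have /open_enormP/(_ _ Ox)[r r0 rO] := oO.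
have [|q [_ qO] /rO Oq] := @bdist_adherent x r; first exact: le_lt_trans d0 r0.
by apply: qO; rewrite (interior_id _).1//.
Qed.

Lemma measurable_bdist : measurable_fun setT (bdist Omega).
Proof. by apply: measurable_fun_lipschitz; exact: bdist_lipschitz. Qed.

End boundary_distance.

Section strip.
Context {R : realType}.
Local Notation mu n := (@rV_lebesgue R n).

Variables (m : nat) (Omega : set 'rV[R]_m.+1).
Hypothesis O_dom : bounded_C11_domain Omega.

Let oO : open Omega. Proof. by case: O_dom. Qed.

Let bO : boundary Omega !=set0. Proof. exact: domain_boundary_nonempty. Qed.

Definition ball_strip (y : 'rV[R]_m.+1) (r t : R) :=
  [set x | [/\ Omega x, bdist Omega x < t & enorm (x - y) < r]].

Lemma measurable_enorm_ball n (y : 'rV[R]_n) (r : R) :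
  measurable [set x | enorm (x - y) < r].
Proof.
apply: measurable_lt_fun.
exact: (@measurable_enorm _ _ _ _ id (cst y)).
Qed.

Lemma measurable_ball_strip y r t : measurable (ball_strip y r t).
Proof.
rewrite (_ : ball_strip y r t = Omega `&`
    ([set x | bdist Omega x < t] `&` [set x | enorm (x - y) < r])).
  apply: measurableI; first exact: open_measurable_rV.
  apply: measurableI; last exact: measurable_enorm_ball.
  by apply: measurable_lt_fun; exact: measurable_bdist.
by apply/seteqP; split => x /=; [move=> []|move=> [? []]].
Qed.

Lemma local_strip_measure p : boundary Omega p ->
  exists2 rho, 0 < rho & exists2 C, 0 <= C & forall y r t,
    0 < r -> 0 < t -> t <= rho ->
    (mu m.+1 (ball_strip y r t `&` [set x | (enorm (x - p) < rho)%R]) <=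
      (C * r ^+ m * t)%:E)%E.
Proof.
case: O_dom => _ _ _ _ /[apply] -[r0 [Q [k [phi [r0_gt0 QQ phiC chart]]]]].
pose z (x : 'rV[R]_m.+1) := x *m Q.
have coordB l (a b : 'rV[R]_l) j : (a - b) ord0 j = a ord0 j - b ord0 j.
  by rewrite !mxE.
have zB x y : enorm (z x - z y) = enorm (x - y).
  by rewrite /z -mulmxBl enorm_orthogonal.
have colB x y : enorm (col' k (z x) - col' k (z y)) <= enorm (x - y).
  by rewrite -zB -linearB/= enorm_col'.
have [M M0 HM] := C11_fun_lipschitz (col' k (z p)) phiC r0_gt0.
(* Two points of one cell differ by at most [m * t] in the graph coordinates, hence by [M * m * t]
   in the value of [phi], while their heights above the graph differ by at most [(M + 1) * t]. The
   three bounds add up to [K * t]. *)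
pose K := m%:R + (M * m%:R + (M + 1)).
have K0 : 0 <= K by rewrite !addr_ge0// mulr_ge0.
exists (r0 / 2); first by rewrite divr_gt0.
exists (2 ^+ m.+1 + 3 ^+ m * (2 * K) ^+ m.+1).
  by rewrite addr_ge0// mulr_ge0// exprn_ge0// mulr_ge0.
move=> y r t r_gt0 t_gt0 tr; set S := _ `&` _.
have mS : measurable S.
  by apply: measurableI; [exact: measurable_ball_strip|exact: measurable_enorm_ball].
(* A boundary point [q] within [t] of [x] still lies in the chart, since [rho] is half the chart
   radius. It is outside the open set [Omega], hence on or below the graph. Passing from [q] to [x]
   changes the coordinate by at most [t] and [phi] by at most [M * t]. *)
have height x : S x -> 0 < z x ord0 k - phi (col' k (z x)) < (M + 1) * t.
  move=> [[Ox /(bdist_adherent bO)[q bq xq] _] /= xp].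
  have xp' : enorm (x - p) < r0 by rewrite (lt_le_trans xp)// ler_pdivrMr//; lra.
  have qp : enorm (q - p) < r0.
    by have := enorm_triangle q x p; rewrite (enormB q x); lra.
  have [+ _] := chart _ xp' => /(_ Ox); rewrite subr_gt0 => ->/=.
  have nOq : ~ Omega q.
    by case: bq => _ + Oq; apply; rewrite (interior_id _).1//.
  have qphi : z q ord0 k <= phi (col' k (z q)).
    by rewrite leNgt; apply/negP => H; apply: nOq; apply/(chart _ qp).
  have := HM (col' k (z q)) (col' k (z x)).
  move=> /(_ (le_lt_trans (colB _ _) qp) (le_lt_trans (colB _ _) xp')).
  have := ler_wpM2l M0 (colB q x); rewrite (enormB q x).
  have := coord_le_enorm (z x - z q) k; rewrite zB coordB => /ler_normlP[_].
  have : M * enorm (x - q) <= M * t by rewrite ler_wpM2l// ltW.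
  lra.
(* For [r < t] the volume of the ball suffices, since [r ^+ m.+1 <= r ^+ m * t]; this is the first
   summand of the constant. *)
have [tr'|rt] := lerP t r; last first.
  have /le_trans : (mu m.+1 S <= ((2 * r) ^+ m.+1)%:E)%E.
    by apply: (measure_ball_le (y := y)) => //; [exact: ltW|move=> x [[]]].
  apply; rewrite lee_fin exprMn -mulrA mulrDl.
  rewrite (exprSr r) -[leLHS]addr0 lerD//.
    by rewrite ler_wpM2l ?exprn_ge0// ler_wpM2l ?exprn_ge0 ?ltW.
  by do ?apply: mulr_ge0; try apply: exprn_ge0; rewrite ?mulr_ge0// ltW.
(* Only the [m] graph coordinates are sorted into cells; the remaining coordinate is controlled by
   [height]. *)
have /le_trans : (mu m.+1 S <= ((3 * r / t) ^+ m * (2 * (K * t)) ^+ m.+1)%:E)%E.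
  apply: (@measure_cells _ _ _ _ (fun x i => col' k (z x) ord0 i)
    (fun i => col' k (z y) ord0 i)) => //.
    move=> x i [[_ _ xy] _]; apply: le_lt_trans xy.
    apply: le_trans (colB x y).
    by have := coord_le_enorm (col' k (z x) - col' k (z y)) i; rewrite coordB.
  move=> x1 x2 S1 S2 cellE j.
  have col_le : enorm (col' k (z x1) - col' k (z x2)) <= m%:R * t.
    apply: enorm_le => [|i]; first exact: ltW.
    by have /ltW := cellE i; rewrite coordB.
  have near_p x : S x -> enorm (col' k (z x) - col' k (z p)) < r0.
    by move=> [_ /= xp]; apply: le_lt_trans (colB _ _) _; lra.
  have H12 := HM _ _ (near_p _ S1) (near_p _ S2).
  have H21 := HM _ _ (near_p _ S2) (near_p _ S1).
  have /andP[? ?] := height _ S1; have /andP[? ?] := height _ S2.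
  have Mcol := ler_wpM2l M0 col_le.
  have zk : `|(z x1 - z x2) ord0 k| <= M * (m%:R * t) + (M + 1) * t.
    rewrite (enormB (col' k (z x2))) in H21.
    by rewrite coordB ler_norml; apply/andP; split; lra.
  have := coord_le_enorm (x1 - x2) j; rewrite coordB => /le_trans; apply.
  rewrite -zB (le_trans (enorm_le_col' k _))// linearB/= /K !mulrDl.
  by rewrite mulrDl in zk; lra.
apply; rewrite lee_fin [leLHS](_ : _ = 3 ^+ m * (2 * K) ^+ m.+1 * r ^+ m * t).
  by rewrite !mulrDl lerDr !mulr_ge0 ?exprn_ge0// ltW.
rewrite !exprMn exprVn (exprSr t).
have : t ^+ m != 0 by rewrite expf_neq0 ?gt_eqF.
by move: (t ^+ m) => ? ?; field.
Qed.

End strip.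

Section global_strip.
Context {R : realType} (m : nat) (Omega : set 'rV[R]_m.+1).
Local Notation mu n := (@rV_lebesgue R n).
Hypothesis O_dom : bounded_C11_domain Omega.

Let oO : open Omega. Proof. by case: O_dom. Qed.

Let bO : boundary Omega !=set0. Proof. exact: domain_boundary_nonempty. Qed.

Lemma compact_boundary : compact (boundary Omega).
Proof.
have [_ _ _ /bounded_enormP[M M0 OM] _] := O_dom.
apply: bounded_closed_compact.
  exists (M + 1); split; first by rewrite num_real.
  move=> K MK q [/closure_enormP/(_ _ ltr01)[x Ox qx] _].
  rewrite /= [leLHS]/Num.norm/= mx_normrE.
  apply: bigmax_le => [|[i j] _]; first by apply: ltW; apply: lt_trans MK; lra.
  rewrite (ord1 i)/= (le_trans (coord_le_enorm _ _))//.
  have := enorm_triangle q x 0; rewrite !subr0; have := OM _ Ox; lra.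
rewrite /boundary setDE; apply: closedI; first exact: closed_closure.
by rewrite closedC; exact: open_interior.
Qed.

(** By compactness finitely many balls of half the local radius cover the boundary. If [t0] is at
    most each of these half radii, a point within [t0] of the boundary falls into one of the full
    balls, and the local constants are added. *)
Lemma near_boundary_strip_measure : exists2 t0, 0 < t0 & exists2 C, 0 <= C &
  forall y r t, 0 < r -> 0 < t -> t < t0 ->
    (mu m.+1 (ball_strip Omega y r t) <= (C * r ^+ m * t)%:E)%E.
Proof.
pose P p rho C := 0 <= C /\ forall y r t, 0 < r -> 0 < t -> t <= rho ->
  (mu m.+1 (ball_strip Omega y r t `&` [set x | (enorm (x - p) < rho)%R]) <=
    (C * r ^+ m * t)%:E)%E.
(* The default radius 1 off the boundary makes the chosen radius a positive function defined
   everywhere. *)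
have loc p : exists rho, 0 < rho /\ (boundary Omega p -> exists C, P p rho C).
  have [/(local_strip_measure O_dom)[rho rho0 [C C0 HC]]|np] :=
    pselect (boundary Omega p); last by exists 1.
  by exists rho; split => // _; exists C.
pose rho p := sval (cid (loc p)).
have rho0 p : 0 < rho p by rewrite /rho; case: cid => ? [].
have rhoP p : boundary Omega p -> exists C, P p (rho p) C.
  by rewrite /rho; case: cid => ? [].
have : cover_compact (boundary Omega).
  by rewrite -compact_cover; exact: compact_boundary.
move=> /(_ _ (boundary Omega) (fun p => [set x | enorm (x - p) < rho p / 2])).
case=> [p _|q bq|D Dsub Dcov].
- apply/open_enormP => x /= xp; exists (rho p / 2 - enorm (x - p)); first lra.
  by move=> y xy; have := enorm_triangle y x p; rewrite (enormB y x); lra.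
- by exists q => //=; rewrite subrr enorm0 divr_gt0.
have key (s : seq 'rV[R]_m.+1) : (forall p, p \in s -> boundary Omega p) ->
  exists2 t0, 0 < t0 & exists2 C, 0 <= C & (forall p, p \in s -> t0 <= rho p / 2) /\
    forall y r t, 0 < r -> 0 < t -> t < t0 ->
    (mu m.+1 (ball_strip Omega y r t `&`
       [set x | exists2 p, p \in s & (enorm (x - p) < rho p)%R]) <=
       (C * r ^+ m * t)%:E)%E.
  elim: s => [_|p s IH bs].
    exists 1 => //; exists 0 => //; split => // y r t _ _ _.
    rewrite (_ : _ `&` _ = set0) ?measure0 ?mul0r//.
    by apply/seteqP; split => x // -[_ []].
  have [|t0 t0_gt0 [C C0 [sr HC]]] := IH.
    by move=> q qs; apply: bs; rewrite inE qs orbT.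
  have [Cp [Cp0 HCp]] := rhoP _ (bs p (mem_head _ _)).
  exists (Num.min t0 (rho p / 2)); first by rewrite lt_min t0_gt0 divr_gt0.
  exists (Cp + C); first exact: addr_ge0.
  split=> [q|y r t r0 t_gt0].
    rewrite inE => /predU1P[->|qs]; first by rewrite ge_min lexx orbT.
    by rewrite ge_min sr.
  rewrite lt_min => /andP[tt0 tp].
  have mB q : measurable (ball_strip Omega y r t `&` [set x | enorm (x - q) < rho q]).
    by apply: measurableI; [exact: measurable_ball_strip|exact: measurable_enorm_ball].
  have mE : measurable (ball_strip Omega y r t `&`
      [set x | exists2 q, q \in s & enorm (x - q) < rho q]).
    apply: measurableI; first exact: measurable_ball_strip.
    rewrite (_ : [set x | _] =
      \big[setU/set0]_(q <- s) [set x | enorm (x - q) < rho q]).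
      by apply: bigsetU_measurable => q _; exact: measurable_enorm_ball.
    rewrite -bigcup_seq; apply/seteqP.
    by split => x [q ? ?]; exists q.
  rewrite (_ : _ `&` _ =
      (ball_strip Omega y r t `&` [set x | enorm (x - p) < rho p]) `|`
      (ball_strip Omega y r t `&` [set x | exists2 q, q \in s & enorm (x - q) < rho q])).
    apply: le_trans (measureU2 _ _ _) _ => //.
    rewrite !mulrDl EFinD; apply: leeD; last exact: HC.
    by apply: HCp => //; have := rho0 p; lra.
  rewrite -setIUr; congr (_ `&` _); apply/seteqP; split => x /=.
    by move=> [q]; rewrite inE => /predU1P[->|qs] xq; [left|right; exists q].
  by move=> [xp|[q qs xq]]; [exists p|exists q]; rewrite // inE ?eqxx// qs orbT.
have [|t0 t0_gt0 [C C0 [sr HC]]] := key (finmap.enum_fset D).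
  by move=> p pD; have := Dsub _ pD; rewrite inE.
exists t0 => //; exists C => // y r t r0 t_gt0 tt0.
rewrite (_ : ball_strip Omega y r t = ball_strip Omega y r t `&`
  [set x | exists2 p, p \in finmap.enum_fset D & enorm (x - p) < rho p]); first exact: HC.
apply/esym/setIidl => x [Ox /(bdist_adherent bO)[q bq xq] _].
have [p pD /= qp] := Dcov _ bq; exists p => //=.
have := sr _ pD; have := enorm_triangle x q p; lra.
Qed.

(** The restriction [t < t0] is removed by enlarging the constant. For [t >= t0] and [r <= t] the
    volume of the ball is enough. For [r > t >= t0] the volume of a ball containing [Omega] is
    enough, because [t * r ^+ m] is at least [t0 ^+ m.+1]. *)
Lemma ball_strip_measure : exists2 A, 0 <= A &
  forall y r t, 0 < r -> 0 < t ->
    (mu m.+1 (ball_strip Omega y r t) <= (A * t * r ^+ m)%:E)%E.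
Proof.
have [t0 t0_gt0 [C C0 HC]] := near_boundary_strip_measure.
have [_ _ _ /bounded_enormP[M M0 OM] _] := O_dom.
exists (C + (2 ^+ m.+1 + (2 * M) ^+ m.+1 / t0 ^+ m.+1)).
  by rewrite !addr_ge0// ?divr_ge0 ?exprn_ge0 ?mulr_ge0// ltW.
move=> y r t r0 t_gt0; have mS := measurable_ball_strip O_dom y r t.
have rt0 : 0 <= t * r ^+ m by rewrite mulr_ge0 ?exprn_ge0// ltW.
have C2 : 0 <= 2 ^+ m.+1 :> R by rewrite exprn_ge0.
have C3 : 0 <= (2 * M) ^+ m.+1 / t0 ^+ m.+1.
  by rewrite divr_ge0 ?exprn_ge0 ?mulr_ge0// ltW.
have wk (a : R) : a <= C + (2 ^+ m.+1 + (2 * M) ^+ m.+1 / t0 ^+ m.+1) ->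
    a * t * r ^+ m <= (C + (2 ^+ m.+1 + (2 * M) ^+ m.+1 / t0 ^+ m.+1)) * t * r ^+ m.
  by move=> H; rewrite -!(mulrA _ t) ler_wpM2r.
have [tt0|t0t] := ltrP t t0.
  apply: le_trans (HC _ _ _ r0 t_gt0 tt0) _; rewrite lee_fin mulrAC.
  by apply: wk; rewrite lerDl addr_ge0.
have [rt|tr] := lerP r t.
  have /le_trans : (mu m.+1 (ball_strip Omega y r t) <= ((2 * r) ^+ m.+1)%:E)%E.
    by apply: (measure_ball_le (y := y)) => //; [exact: ltW|move=> x []].
  apply; rewrite lee_fin; apply: le_trans (wk (2 ^+ m.+1) _); last lra.
  rewrite exprMn -mulrA ler_wpM2l// exprS ler_wpM2r// exprn_ge0// ltW//.
have /le_trans : (mu m.+1 (ball_strip Omega y r t) <= ((2 * M) ^+ m.+1)%:E)%E.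
  apply: (measure_ball_le (y := 0)) => //; first exact: ltW.
  by move=> x [Ox _ _]; rewrite subr0; exact: OM.
apply; rewrite lee_fin.
apply: le_trans (wk ((2 * M) ^+ m.+1 / t0 ^+ m.+1) _); last lra.
have tr0 : t0 ^+ m.+1 <= t * r ^+ m.
  rewrite exprS; apply: ler_pM => //; rewrite ?exprn_ge0 ?(ltW t0_gt0)//.
  by apply: lerXn2r; rewrite ?nnegrE ?(ltW t0_gt0) ?(ltW r0)//; lra.
rewrite -mulrA mulrAC -mulrA ler_peMr//; last first.
  by rewrite mulrC ler_pdivlMl ?exprn_gt0// mulr1.
by rewrite exprn_ge0// mulr_ge0// ltW.
Qed.

End global_strip.

(** * Monotonicity and exponent rules for real powers *)

Section powR_facts.
Context {R : realType}.
Implicit Types x y a b : R.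

Lemma powR_le_base x y a : 0 <= a -> 0 <= x -> x <= y -> x `^ a <= y `^ a.
Proof.
by move=> a0 x0 xy; apply: ge0_ler_powR; rewrite ?nnegrE// (le_trans x0).
Qed.

Lemma powRN_le_base x y a : 0 <= a -> 0 < x -> x <= y -> y `^ (- a) <= x `^ (- a).
Proof.
move=> a0 x0 xy; have y0 : 0 < y by exact: lt_le_trans xy.
by rewrite !powRN lef_pV2 ?posrE ?powR_gt0// powR_le_base// ltW.
Qed.

Lemma powRD_gt0 x a b : 0 < x -> x `^ (a + b) = x `^ a * x `^ b.
Proof. by move=> x0; rewrite powRD// (gt_eqF x0) implybT. Qed.

Lemma powR_1D x a : 0 < x -> x `^ (1 + a) = x * x `^ a.
Proof. by move=> x0; rewrite powRD_gt0// powRr1// ltW. Qed.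

End powR_facts.

(** * Dyadic shells *)

Section shells.
Context d {T : measurableType d} {R : realType}.
Variable nu : {measure set T -> \bar R}.
Local Open Scope ereal_scope.

Lemma ge0_le_integral_nonmeasurable (D : set T) (f g : T -> \bar R) :
  (forall x, D x -> 0 <= f x) -> (forall x, D x -> f x <= g x) ->
  \int[nu]_(x in D) f x <= \int[nu]_(x in D) g x.
Proof.
move=> f0 fg; rewrite !ge0_integralE//; last first.
  by move=> x Dx; exact: le_trans (f0 x Dx) (fg x Dx).
apply: ereal_sup_le => _ [h /= hf <-]; exists h => //= x.
apply: le_trans (hf x) _; rewrite /patch; case: ifPn => // /[!inE]; exact: fg.
Qed.

Lemma nneseries_le (u : nat -> \bar R) (B : \bar R) : (forall j, 0 <= u j) ->
  (forall N, \sum_(0 <= j < N) u j <= B) -> \sum_(0 <= j <oo) u j <= B.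
Proof.
move=> u0 uB; apply: lime_le; first by apply: is_cvg_nneseries => *; exact: u0.
by apply: nearW => N; exact: uB.
Qed.

(** The integrand is dominated by the series of [a j] times the indicator of [S j], which is
    integrated term by term. The shells may overlap. *)
Lemma integral_shells (E : set T) (S : nat -> set T) (g : T -> R)
    (a v : nat -> R) (B : R) :
  measurable E -> (forall j, measurable (S j)) ->
  (forall x, E x -> (0 <= g x)%R) -> (forall x, E x -> exists j, S j x) ->
  (forall j x, E x -> S j x -> (g x <= a j)%R) -> (forall j, (0 <= a j)%R) ->
  (forall j, nu (E `&` S j) <= (v j)%:E) ->
  (forall N, (\sum_(0 <= j < N) a j * v j <= B)%R) ->
  \int[nu]_(x in E) (g x)%:E <= B%:E.
Proof.
move=> mE mS g0 ES ga a0 Sv avB.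
pose h j x := (a j * \1_(S j) x)%:E.
have h0 j x : 0 <= h j x by rewrite lee_fin mulr_ge0// indicE.
have mh j : measurable_fun E (h j).
  apply/measurable_EFinP/measurable_funM; first exact: measurable_cst.
  exact: measurable_indic.
apply: (@le_trans _ _ (\int[nu]_(x in E) \sum_(0 <= j <oo) h j x)).
  apply: ge0_le_integral_nonmeasurable => x Ex; first by rewrite lee_fin g0.
  have [j Sj] := ES _ Ex.
  apply: (@le_trans _ _ (h j x)).
    by rewrite /h lee_fin indicE mem_set//= mulr1 ga.
  apply: le_trans (nneseries_lim_ge j.+1 _) => //.
  by rewrite big_nat_recr//= leeDr// sume_ge0.
rewrite integral_nneseries//; apply: nneseries_le => [j|N].
  exact: integral_ge0.
apply: le_trans (_ : (\sum_(0 <= j < N) a j * v j)%R%:E <= _); last first.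
  by rewrite lee_fin.
rewrite -sumEFin; apply: lee_sum => j _.
under eq_integral do rewrite /h EFinM.
rewrite ge0_integralZl_EFin//; last first.
  by apply/measurable_EFinP; exact: measurable_indic.
by rewrite integral_indic// EFinM lee_wpmul2l ?lee_fin// setIC.
Qed.

End shells.

Section power_shells.
Context d {T : measurableType d} {R : realType}.
Variable nu : {measure set T -> \bar R}.
Variable rho : T -> R.
Hypothesis mrho : measurable_fun setT rho.

Lemma powRX (x b : R) j : 0 <= x -> (x ^+ j) `^ b = (x `^ b) ^+ j.
Proof. by move=> x0; rewrite -powR_mulrn// powRAC powR_mulrn// powR_ge0. Qed.

Lemma measurable_shell (a b : R) : measurable [set x | a <= rho x < b].
Proof.
rewrite (_ : [set x | a <= rho x < b] = setT `&` rho @^-1` `[a, b[%classic).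
  by apply: mrho => //; exact: measurable_itv.
by rewrite setTI; apply/seteqP; split => x /=; rewrite in_itv/=.
Qed.

Lemma card_ord_lt N J : (#|[pred i : 'I_N | (i < J)%N]| <= J)%N.
Proof.
case: J => [|J]; first by rewrite eq_card0.
have inj : {in [pred i : 'I_N | (i < J.+1)%N] &,
    injective (fun i : 'I_N => inord i : 'I_J.+1)}.
  move=> i k; rewrite !inE => iJ kJ /(congr1 (@nat_of_ord _)).
  by rewrite !inordK// => /val_inj.
by rewrite -(card_in_imset inj) (leq_trans (max_card _))// card_ord.
Qed.

Lemma dyadic_floor (w : R) : 1 <= w -> exists j, 2 ^+ j <= w < 2 ^+ j.+1.
Proof.
move=> w1.
have ex : exists j, w < 2 ^+ j.+1.
  exists (Num.trunc w); apply: (lt_le_trans (truncnS_gt _)).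
  by rewrite -natrX ler_nat ltnW// ltn_expl.
exists (ex_minn ex); case: ex_minnP => -[|j] wj jmin; first by rewrite expr0 w1.
by rewrite wj andbT leNgt; apply/negP => /jmin; rewrite ltnn.
Qed.

(** The bound of the integrand on the [j]-th outward shell times the bound of its measure is a
    geometric term of ratio [2 ^ (m - b)], so the sign of [m - b] decides between convergence and
    logarithmic growth. *)
Lemma dyadic_term (r0 b A : R) m j : 0 < r0 ->
  (2 ^+ j * r0) `^ (- b) * (A * (2 ^+ j.+1 * r0) ^+ m) =
  2 ^+ m * A * r0 `^ (m%:R - b) * (2 `^ (m%:R - b)) ^+ j.
Proof.
move=> r0_gt0; have j0 : 0 < 2 ^+ j :> R by rewrite exprn_gt0.
have E (x : R) : 0 < x -> x `^ (m%:R - b) = x `^ (- b) * x ^+ m.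
  move=> x0; rewrite -powR_mulrn ?(ltW x0)// -powRD; first by rewrite addrC.
  by rewrite (gt_eqF x0) implybT.
rewrite -powRX// !E// powRM ?ltW// exprS !exprMn; ring.
Qed.

(** The counterpart for shells shrinking to the singularity: the ratio is now [2 ^ (b - m)]. *)
Lemma dyadic_term_inv (r0 b A : R) m j : 0 < r0 ->
  (r0 / 2 ^+ j.+1) `^ (- b) * (A * (2 * r0 / 2 ^+ j) ^+ m) =
  2 `^ b * 2 ^+ m * A * r0 `^ (m%:R - b) * (2 `^ (b - m%:R)) ^+ j.
Proof.
move=> r0_gt0; have j0 : 0 < 2 ^+ j :> R by rewrite exprn_gt0.
have E (x : R) : 0 < x -> x `^ (m%:R - b) = x `^ (- b) * x ^+ m.
  move=> x0; rewrite -powR_mulrn ?(ltW x0)// -powRD; first by rewrite addrC.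
  by rewrite (gt_eqF x0) implybT.
have E' (x : R) : 0 < x -> x `^ (b - m%:R) = x `^ b * (x ^+ m)^-1.
  move=> x0; rewrite -powR_mulrn ?(ltW x0)// -powRN -powRD//.
  by rewrite (gt_eqF x0) implybT.
have V (x : R) : 0 < x -> x^-1 `^ (- b) = x `^ b.
  by move=> x0; rewrite -[x^-1]powR_inv1 ?ltW// -powRrM mulN1r opprK.
have -> : (r0 / 2 ^+ j.+1) `^ (- b) = r0 `^ (- b) * (2 `^ b * (2 ^+ j) `^ b).
  by rewrite powRM ?invr_ge0 ?exprn_ge0 ?ltW// V ?exprn_gt0// exprS powRM ?ltW.
rewrite -powRX// E// E'// !exprMn exprVn; ring.
Qed.

Lemma dyadic_sum_le (K q : R) N : 0 <= K -> 0 < q < 1 ->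
  \sum_(0 <= j < N) K * q ^+ j <= K / (1 - q).
Proof.
move=> K0 /andP[q0 q1]; apply: (geometric_le_lim N K0 q0).
by rewrite ger0_norm// ltW.
Qed.

Let powR_lt1 (x : R) : x < 0 -> 0 < 2 `^ x < 1.
Proof.
move=> x0; rewrite powR_gt0//= /powR pnatr_eq0/= expR_lt1.
by rewrite pmulr_llt0// ln_gt0// ltr1n.
Qed.

Variables (E : set T) (A r0 b : R) (m : nat).
Hypotheses (mE : measurable E) (A0 : 0 <= A) (r0_gt0 : 0 < r0) (b0 : 0 <= b).
Hypothesis Egrowth : forall r, 0 < r ->
  (nu (E `&` [set x | (rho x < r)%R]) <= (A * r ^+ m)%:E)%E.

Let growth_shell (c r : R) : 0 < r ->
  (nu (E `&` [set x | (c <= rho x < r)%R]) <= (A * r ^+ m)%:E)%E.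
Proof.
move=> r_gt0; apply: le_trans (Egrowth r_gt0); apply: le_measure.
- by rewrite inE; apply: measurableI => //; exact: measurable_shell.
- by rewrite inE; apply: measurableI => //; exact: measurable_lt_fun.
- by move=> x [Ex /= /andP[_ ?]].
Qed.

Lemma integral_power_near : b < m%:R ->
  (forall x, E x -> 0 < rho x < r0) ->
  (\int[nu]_(x in E) (rho x `^ (- b))%:E <=
    (2 `^ b * 2 ^+ m / (1 - 2 `^ (b - m%:R)) * A * r0 `^ (m%:R - b))%:E)%E.
Proof.
move=> bm Er.
(* Inverting [2 ^+ j <= r0 / rho x] gives only a weak upper bound on [rho x]; doubling the outer
   radius makes it strict, as the growth hypothesis requires. *)
pose S j := [set x | r0 / 2 ^+ j.+1 <= rho x < 2 * r0 / 2 ^+ j].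
apply: (@integral_shells _ _ _ _ _ S _ (fun j => (r0 / 2 ^+ j.+1) `^ (- b))
    (fun j => A * (2 * r0 / 2 ^+ j) ^+ m)) => //.
- by move=> j; exact: measurable_shell.
- by move=> x _; exact: powR_ge0.
- move=> x /Er/andP[x0 xr].
  have [|j /andP[jl jr]] := @dyadic_floor (r0 / rho x).
    by rewrite ler_pdivlMr// mul1r ltW.
  exists j; rewrite /S/= ler_pdivrMr ?exprn_gt0// ltr_pdivlMr ?exprn_gt0//.
  move: jl jr; rewrite ler_pdivlMr// ltr_pdivrMr// => ? ?.
  by apply/andP; split; [rewrite mulrC ltW|rewrite mulrC; lra].
- move=> j x _ /andP[jx _]; apply: powRN_le_base => //.
  by rewrite divr_gt0// exprn_gt0.
- by move=> j; exact: powR_ge0.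
- by move=> j; apply: growth_shell; rewrite !mulr_gt0// invr_gt0 exprn_gt0.
- move=> N; under eq_bigr do rewrite dyadic_term_inv//.
  apply: le_trans (dyadic_sum_le _ _ _) _.
  + by rewrite !mulr_ge0 ?powR_ge0 ?exprn_ge0.
  + by apply: powR_lt1; rewrite subr_lt0.
  + by rewrite le_eqVlt; apply/orP; left; apply/eqP; ring.
Qed.

Lemma integral_power_far : m%:R < b -> (forall x, E x -> r0 <= rho x) ->
  (\int[nu]_(x in E) (rho x `^ (- b))%:E <=
    (2 ^+ m / (1 - 2 `^ (m%:R - b)) * A * r0 `^ (m%:R - b))%:E)%E.
Proof.
move=> bm Er.
pose S j := [set x | 2 ^+ j * r0 <= rho x < 2 ^+ j.+1 * r0].
apply: (@integral_shells _ _ _ _ _ S _ (fun j => (2 ^+ j * r0) `^ (- b))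
    (fun j => A * (2 ^+ j.+1 * r0) ^+ m)) => //.
- by move=> j; exact: measurable_shell.
- by move=> x _; exact: powR_ge0.
- move=> x /Er xr.
  have [|j /andP[jl jr]] := @dyadic_floor (rho x / r0).
    by rewrite ler_pdivlMr// mul1r.
  by exists j; rewrite /S/= -ler_pdivlMr// -ltr_pdivrMr// jl.
- move=> j x _ /andP[jx _]; apply: powRN_le_base => //.
  by rewrite mulr_gt0// exprn_gt0.
- by move=> j; exact: powR_ge0.
- by move=> j; apply: growth_shell; rewrite !mulr_gt0// exprn_gt0.
- move=> N; under eq_bigr do rewrite dyadic_term//.
  apply: le_trans (dyadic_sum_le _ _ _) _.
  + by rewrite !mulr_ge0 ?powR_ge0 ?exprn_ge0.
  + by apply: powR_lt1; rewrite subr_lt0.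
  + by rewrite le_eqVlt; apply/orP; left; apply/eqP; ring.
Qed.

(** At the critical exponent every shell contributes the same amount [2 ^+ m * A], and only [J]
    shells meet [E]; the later ones are taken empty. *)
Lemma integral_power_log J : b = m%:R ->
  (forall x, E x -> r0 <= rho x < 2 ^+ J * r0) ->
  (\int[nu]_(x in E) (rho x `^ (- b))%:E <= (2 ^+ m * A * J%:R)%:E)%E.
Proof.
move=> bm Er.
pose S j := if (j < J)%N then [set x | 2 ^+ j * r0 <= rho x < 2 ^+ j.+1 * r0] else set0.
apply: (@integral_shells _ _ _ _ _ S _ (fun j => (2 ^+ j * r0) `^ (- b))
    (fun j => if (j < J)%N then A * (2 ^+ j.+1 * r0) ^+ m else 0)) => //.
- by move=> j; rewrite /S; case: ifP => _ //; exact: measurable_shell.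
- by move=> x _; exact: powR_ge0.
- move=> x /Er /andP[xr xJ].
  have [|j /andP[jl jr]] := @dyadic_floor (rho x / r0).
    by rewrite ler_pdivlMr// mul1r.
  exists j; rewrite /S; case: ltnP => Jj/=; first by rewrite -ler_pdivlMr// -ltr_pdivrMr// jl.
  move: jl; rewrite leNgt => /negP; apply.
  rewrite ltr_pdivrMr// (lt_le_trans xJ)// ler_pM2r// ler_eXn2l ?ltr1n//.
- move=> j x _; rewrite /S; case: ifP => // _ /andP[jx _]; apply: powRN_le_base => //.
  by rewrite mulr_gt0// exprn_gt0.
- by move=> j; exact: powR_ge0.
- move=> j; rewrite /S; case: ifP => _; last by rewrite setI0 measure0.
  by apply: growth_shell; rewrite !mulr_gt0// exprn_gt0.
- move=> N; apply: (@le_trans _ _ (\sum_(0 <= j < N | (j < J)%N) 2 ^+ m * A)).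
    rewrite [leRHS]big_mkcond/=; apply: ler_sum => j _; case: ifP => _; last by rewrite mulr0.
    by rewrite dyadic_term// bm subrr !powRr0 expr1n !mulr1.
  rewrite big_mkord sumr_const -[leLHS]mulr_natr ler_wpM2l ?mulr_ge0 ?exprn_ge0//.
  by rewrite ler_nat card_ord_lt.
Qed.

End power_shells.

(** * Green kernel estimates on strips *)

Section setID.
Context d {T : measurableType d} {R : realType}.
Variable nu : {measure set T -> \bar R}.
Local Open Scope ereal_scope.

Lemma ge0_integral_setID (D P : set T) (f : T -> \bar R) :
  measurable D -> measurable P -> measurable_fun setT f -> (forall x, 0 <= f x) ->
  \int[nu]_(x in D) f x =
  \int[nu]_(x in D `&` P) f x + \int[nu]_(x in D `\` P) f x.
Proof.
move=> mD mP mf f0; rewrite -[in LHS](setUIDK D P) ge0_integral_setU//.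
- exact: measurableI.
- exact: measurableD.
- exact: measurable_funS mf.
- by apply/disj_setPS => x [[_ ?] [_]].
Qed.

Lemma ge0_integral_le_scale (D : set T) (f g : T -> R) (c B : R) :
  measurable D -> (0 <= c)%R -> measurable_fun setT g -> (forall x, (0 <= g x)%R) ->
  (forall x, D x -> (0 <= f x <= c * g x)%R) ->
  \int[nu]_(x in D) (g x)%:E <= B%:E ->
  \int[nu]_(x in D) (f x)%:E <= (c * B)%:E.
Proof.
move=> mD c0 mg g0 fg gB.
apply: (@le_trans _ _ (\int[nu]_(x in D) (c%:E * (g x)%:E))).
  apply: ge0_le_integral_nonmeasurable => x /fg /andP[? ?].
    by rewrite lee_fin.
  by rewrite -EFinM lee_fin.
rewrite ge0_integralZl_EFin//; last first.
- by apply/measurable_EFinP; exact: measurable_funS mg.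
- by move=> x _; rewrite lee_fin.
by rewrite EFinM lee_wpmul2l// lee_fin.
Qed.

End setID.

Section kernel.
Context {R : realType} (m : nat) (Omega : set 'rV[R]_m.+1) (s gamma : R).
Local Notation mu := (@rV_lebesgue R m.+1).
Local Notation delta := (bdist Omega).
Hypothesis O_dom : bounded_C11_domain Omega.
Hypotheses (s01 : 0 < s <= 1) (gamma01 : 0 < gamma <= 1) (s_le : 2 * s <= m.+1%:R).

Let oO : open Omega. Proof. by case: O_dom. Qed.
Let mO : measurable Omega. Proof. exact: open_measurable_rV. Qed.
Let bO : boundary Omega !=set0. Proof. exact: domain_boundary_nonempty. Qed.
Let s0 : 0 < s. Proof. by case/andP: s01. Qed.
Let g0 : 0 < gamma. Proof. by case/andP: gamma01. Qed.

Local Notation k := (green_profile Omega s gamma).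

(** The order of the singularity once both boundary factors have been pulled out of the minimum.
    Since [b - m = 2 * (gamma - (s - 1/2))], its position relative to the growth exponent [m] of the
    strip separates the three cases. *)
Definition singular_exponent := m.+1%:R - 2 * s + 2 * gamma.
Local Notation b := singular_exponent.

Let b0 : 0 <= b. Proof. by rewrite /b; have := s_le; have := g0; lra. Qed.

Lemma green_profile_ge0 x y : 0 <= k x y.
Proof. by rewrite mulr_ge0 ?invr_ge0 ?powR_ge0. Qed.

(** Division by zero yields zero, so the minimum vanishes on the diagonal and so does its positive
    power. The diagonal can therefore be removed from the strip at no cost. *)
Lemma green_profile_diag x : k x x = 0.
Proof.
rewrite /green_profile subrr enorm0 expr0n/= invr0 mulr0 minElt ltr01.
by rewrite (powR0 (lt0r_neq0 g0)) mulr0.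
Qed.

(** The first branch of the minimum; all powers of the distance collect into [b]. *)
Lemma green_profile_le_far x y : x != y ->
  k x y <= (delta x * delta y) `^ gamma * enorm (x - y) `^ (- b).
Proof.
move=> xy; have r0 : 0 < enorm (x - y) by rewrite enorm_gt0// subr_eq0.
have ud0 : 0 <= delta x * delta y by rewrite mulr_ge0 ?bdist_ge0.
rewrite /green_profile -powRN (_ : - b = - (m.+1%:R - 2 * s) + - gamma * 2); last first.
  by rewrite /b; ring.
rewrite powRD_gt0// mulrCA ler_wpM2l ?powR_ge0//.
apply: (@le_trans _ _ ((delta x * delta y / enorm (x - y) ^+ 2) `^ gamma)).
  apply: powR_le_base; first exact: ltW.
    by rewrite le_min ler01 andbT divr_ge0// sqr_ge0.
  by rewrite ge_min lexx.
rewrite powRM ?invr_ge0 ?sqr_ge0// ler_wpM2l ?powR_ge0//.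
rewrite -powR_inv1 ?sqr_ge0// -powR_mulrn ?(ltW r0)// -!powRrM.
by rewrite (_ : 2 * (-1 * gamma) = - gamma * 2)//; ring.
Qed.

Lemma green_profile_le_near x y : k x y <= enorm (x - y) `^ (- (m.+1%:R - 2 * s)).
Proof.
rewrite /green_profile -powRN ler_piMr ?powR_ge0//.
apply: (@le_trans _ _ (1 `^ gamma)); last by rewrite powR1.
apply: powR_le_base; first exact: ltW.
  by rewrite le_min ler01 andbT divr_ge0 ?sqr_ge0// mulr_ge0 ?bdist_ge0.
by rewrite ge_min lexx orbT.
Qed.

Lemma measurable_green_profile :
  measurable_fun setT (fun z : 'rV[R]_m.+1 * 'rV[R]_m.+1 => k z.1 z.2).
Proof.
have mr : measurable_fun setT
    (fun z : 'rV[R]_m.+1 * 'rV[R]_m.+1 => enorm (z.1 - z.2)).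
  by apply: measurable_enorm; [exact: measurable_fst|exact: measurable_snd].
have md := measurable_bdist bO.
have minv (h : 'rV[R]_m.+1 * 'rV[R]_m.+1 -> R) : measurable_fun setT h ->
    (forall z, 0 <= h z) -> measurable_fun setT (fun z => (h z)^-1).
  move=> mh h0; under eq_fun do rewrite -powR_inv1//.
  exact: (measurableT_comp (measurable_powR (-1))).
apply: measurable_funM.
  apply: minv => [|z]; last exact: powR_ge0.
  exact: (measurableT_comp (measurable_powR _)).
apply: (measurableT_comp (measurable_powR gamma)).
apply: measurable_minr; last exact: measurable_cst.
apply: measurable_funM.
  by apply: measurable_funM; apply: (measurableT_comp md);
    [exact: measurable_fst|exact: measurable_snd].
apply: minv => [|z]; last exact: sqr_ge0.
exact: measurable_funX.
Qed.

Definition strip_kernel (p : R) (x y : 'rV[R]_m.+1) : R :=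
  k x y * (delta x `^ p)^-1.

Lemma strip_kernel_ge0 p x y : 0 <= strip_kernel p x y.
Proof. by rewrite mulr_ge0 ?green_profile_ge0// invr_ge0 powR_ge0. Qed.

Lemma measurable_strip_kernel p : measurable_fun setT
  (fun z : 'rV[R]_m.+1 * 'rV[R]_m.+1 => strip_kernel p z.1 z.2).
Proof.
apply: measurable_funM; first exact: measurable_green_profile.
under eq_fun do rewrite -powRN.
apply: (measurableT_comp (measurable_powR (- p))).
apply: (measurableT_comp (measurable_bdist bO)); exact: measurable_fst.
Qed.

Lemma measurable_strip_kernel1 p y : measurable_fun setT (strip_kernel p ^~ y).
Proof.
exact (measurableT_comp (measurable_strip_kernel p) (measurable_pair2 y)).
Qed.

Lemma measurable_bd_strip eta : measurable (bd_strip Omega eta).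
Proof.
by apply: measurableI => //; apply: measurable_lt_fun; exact: measurable_bdist.
Qed.

Let mrho (y : 'rV[R]_m.+1) : measurable_fun setT (fun x : 'rV[R]_m.+1 => enorm (x - y)).
Proof. exact: (@measurable_enorm _ _ _ _ id (cst y)). Qed.

(** Inside the strip, balls grow like [r ^+ m] with a constant proportional to [eta]; this is where
    the linear factor [eta] in the far estimates comes from. *)
Let strip_growth : exists2 A, 0 <= A & forall (eta : R) y (E : set 'rV[R]_m.+1),
  0 < eta -> measurable E -> E `<=` bd_strip Omega eta -> forall r, 0 < r ->
  (mu (E `&` [set x | (enorm (x - y) < r)%R]) <= (A * eta * r ^+ m)%:E)%E.
Proof.
have [A A0 HA] := ball_strip_measure O_dom; exists A => // eta y E eta0 mE ES r r0.
apply: le_trans (HA y r eta r0 eta0); apply: le_measure.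
- by rewrite inE; apply: measurableI => //; exact: measurable_enorm_ball.
- by rewrite inE; exact: measurable_ball_strip.
- by move=> x [/ES[Ox xe] /= xr].
Qed.

Let ball_growth y (E : set 'rV[R]_m.+1) : measurable E -> forall r, 0 < r ->
  (mu (E `&` [set x | (enorm (x - y) < r)%R]) <= (2 ^+ m.+1 * r ^+ m.+1)%:E)%E.
Proof.
move=> mE r r0; rewrite -exprMn; apply: (measure_ball_le (y := y)).
- by apply: measurableI => //; exact: measurable_enorm_ball.
- exact: ltW.
- by move=> x [].
Qed.

Let diameter : exists2 D, 0 < D & forall x y, Omega x -> Omega y -> enorm (x - y) < D.
Proof.
have [_ _ _ /bounded_enormP[M M0 OM] _] := O_dom.
exists (M + M); first exact: addr_gt0.
move=> x y Ox Oy; have := enorm_triangle x 0 y; rewrite subr0 sub0r enormN.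
by have := OM _ Ox; have := OM _ Oy; lra.
Qed.

Local Notation off y := (~` [set y]).

Let integral_off_diag p eta y :
  (\int[mu]_(x in bd_strip Omega eta) (strip_kernel p x y)%:E =
   \int[mu]_(x in bd_strip Omega eta `&` [set x | (0 < enorm (x - y))%R])
     (strip_kernel p x y)%:E)%E.
Proof.
rewrite (@ge0_integral_setID _ _ _ mu _ [set x | 0 < enorm (x - y)]).
- rewrite [X in (_ + X)%E]integral0_eq ?adde0// => x [_ /= /negP].
  rewrite -leNgt => xy; have [->|/eqP xny] := pselect (x = y).
    by rewrite /strip_kernel green_profile_diag mul0r.
  by move: xy; rewrite leNgt enorm_gt0// subr_eq0.
- exact: measurable_bd_strip.
- exact: measurable_gt_fun.
- apply/measurable_EFinP; exact: measurable_strip_kernel1.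
- by move=> x; rewrite lee_fin strip_kernel_ge0.
Qed.


Lemma strip_kernel_le_far p x y : Omega x -> x != y ->
  strip_kernel p x y <=
  delta y `^ gamma * delta x `^ (gamma - p) * enorm (x - y) `^ (- b).
Proof.
move=> Ox xy; have u0 := bdist_gt0 bO oO Ox.
rewrite /strip_kernel -powRN powRD_gt0//.
apply: (@le_trans _ _ ((delta x * delta y) `^ gamma * enorm (x - y) `^ (- b) *
    delta x `^ (- p))).
  by rewrite ler_wpM2r ?powR_ge0// green_profile_le_far.
rewrite powRM ?bdist_ge0//.
move: (delta x `^ gamma) (delta y `^ gamma) (delta x `^ (- p))
  (enorm (x - y) `^ (- b)) => a1 a2 a3 a4.
by rewrite (_ : a1 * a2 * a4 * a3 = a2 * (a1 * a3) * a4)//; ring.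
Qed.

Let rho_neq (x y : 'rV[R]_m.+1) : (0 < enorm (x - y)) -> x != y.
Proof. by apply: contraTneq => ->; rewrite subrr enorm0 ltxx. Qed.

Let mstrip_gt eta (y : 'rV[R]_m.+1) :
  measurable (bd_strip Omega eta `&` [set x | 0 < enorm (x - y)]).
Proof. by apply: measurableI; [exact: measurable_bd_strip|exact: measurable_gt_fun]. Qed.

Let mpow y (a : R) :
  measurable_fun setT (fun x : 'rV[R]_m.+1 => enorm (x - y) `^ a).
Proof. exact: (measurableT_comp (measurable_powR a)). Qed.

Let integral_le_power y (a c B : R) (E : set 'rV[R]_m.+1) p :
  measurable E -> 0 <= c ->
  (forall x, E x -> strip_kernel p x y <= c * enorm (x - y) `^ a) ->
  (\int[mu]_(x in E) (enorm (x - y) `^ a)%:E <= B%:E)%E ->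
  (\int[mu]_(x in E) (strip_kernel p x y)%:E <= (c * B)%:E)%E.
Proof.
move=> mE c0 H; apply: (@ge0_integral_le_scale _ _ _ mu E
  (strip_kernel p ^~ y) (fun x => enorm (x - y) `^ a)) => // [x|x Ex].
  exact: powR_ge0.
by rewrite strip_kernel_ge0 H.
Qed.

(** Here [b < m], so the singularity is integrable against the growth of the strip, and the whole
    strip is one near region whose radius is the diameter bound [D]. The weight exponent [gamma]
    cancels the factor in [delta x]. *)
Lemma strip_kernel_integral_c : gamma < s - 2^-1 ->
  exists2 C, 0 <= C & forall eta y, 0 < eta -> Omega y ->
  (\int[mu]_(x in bd_strip Omega eta) (strip_kernel gamma x y)%:E <=
    (C * eta * delta y `^ gamma)%:E)%E.
Proof.
move=> gs; have bm : b < m%:R by rewrite /b -natr1; lra.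
have [A A0 HA] := strip_growth; have [D D0 OD] := diameter.
pose C := 2 `^ b * 2 ^+ m / (1 - 2 `^ (b - m%:R)) * A * D `^ (m%:R - b).
exists `|C| => // eta y eta0 Oy; rewrite integral_off_diag.
set E := _ `&` _; have mE : measurable E by exact: mstrip_gt.
apply: (@le_trans _ _ (delta y `^ gamma * (C * eta))%:E).
  apply: (@integral_le_power y (- b)) => //.
  - exact: powR_ge0.
  - move=> x [[Ox _] /= xy]; apply: le_trans (strip_kernel_le_far _ Ox (rho_neq xy)) _.
    by rewrite subrr powRr0 mulr1.
  rewrite (_ : C * eta =
    2 `^ b * 2 ^+ m / (1 - 2 `^ (b - m%:R)) * (A * eta) * D `^ (m%:R - b)); last first.
    by rewrite /C; ring.
  apply: integral_power_near => //.
  - by rewrite mulr_ge0// ltW.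
  - by apply: HA => // x [].
  - by move=> x [[Ox _] /= ->]; rewrite OD.
rewrite lee_fin mulrC ler_wpM2r ?powR_ge0// ler_wpM2r ?ler_norm// ltW//.
Qed.

(** The exponent [m] is one below the dimension, so ordinary volume growth already produces one
    factor [eta]. *)
Let integral_near_critical eta y (E : set 'rV[R]_m.+1) : measurable E -> 0 < eta ->
  (forall x, E x -> 0 < enorm (x - y) < eta) ->
  (\int[mu]_(x in E) (enorm (x - y) `^ (- m%:R))%:E <=
   ((2 : R) `^ m%:R * 2 ^+ m.+1 / (1 - (2 : R) `^ (- 1)) * 2 ^+ m.+1 * eta)%:E)%E.
Proof.
move=> mE eta0 Er.
have := @integral_power_near _ _ _ mu _ (mrho y) E (2 ^+ m.+1) eta m%:R m.+1.
have e1 : m.+1%:R - m%:R = 1 :> R by rewrite -[m.+1%:R]natr1 addrAC subrr add0r.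
have e2 : m%:R - m.+1%:R = - 1 :> R by rewrite -opprB e1.
rewrite e1 e2 powRr1 ?(ltW eta0)//; apply => //.
- exact: ball_growth.
- by rewrite ltr_nat.
Qed.

(** Here [b = m]. Within distance [eta] of [y] the full dimension gives a multiple of [eta]; beyond
    it, each of the [J] dyadic shells reaching up to [D] contributes a multiple of [eta]. [J] stays
    free and is later taken of order [|ln eta|]. *)
Lemma strip_kernel_integral_b : gamma = s - 2^-1 ->
  exists2 C1, 0 <= C1 & exists2 C2, 0 <= C2 & exists2 D, 0 < D &
  forall J eta y, 0 < eta -> Omega y -> D <= 2 ^+ J * eta ->
  (\int[mu]_(x in bd_strip Omega eta) (strip_kernel gamma x y)%:E <=
    ((C1 + C2 * J%:R) * eta * delta y `^ gamma)%:E)%E.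
Proof.
move=> gs; have bm : b = m%:R by rewrite /b -natr1; lra.
have [A A0 HA] := strip_growth; have [D D0 OD] := diameter.
pose C1 : R := (2 : R) `^ m%:R * 2 ^+ m.+1 / (1 - (2 : R) `^ (- 1)) * 2 ^+ m.+1.
pose C2 : R := 2 ^+ m * A.
exists `|C1| => //; exists C2; first by rewrite mulr_ge0// exprn_ge0.
exists D => // J eta y eta0 Oy DJ; rewrite integral_off_diag.
set E := _ `&` _; have mE : measurable E by exact: mstrip_gt.
have mlt : measurable [set x | enorm (x - y) < eta] by exact: measurable_lt_fun.
rewrite (@ge0_integral_setID _ _ _ _ _ [set x | enorm (x - y) < eta])//; last 2 first.
- by apply/measurable_EFinP; exact: measurable_strip_kernel1.
- by move=> x; rewrite lee_fin strip_kernel_ge0.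
have bound x : E x -> strip_kernel gamma x y <=
    delta y `^ gamma * enorm (x - y) `^ (- m%:R).
  move=> [[Ox _] /= xy]; apply: le_trans (strip_kernel_le_far _ Ox (rho_neq xy)) _.
  by rewrite subrr powRr0 mulr1 bm.
apply: (@le_trans _ _ ((delta y `^ gamma * (C1 * eta))%:E +
    (delta y `^ gamma * (C2 * eta * J%:R))%:E)%E).
  apply: leeD.
    apply: (@integral_le_power y (- m%:R)) => //.
    - exact: measurableI.
    - exact: powR_ge0.
    - by move=> x [Ex _]; exact: bound.
    apply: integral_near_critical => //; first exact: measurableI.
    by move=> x [[_ /= ->] /= ->].
  apply: (@integral_le_power y (- m%:R)) => //.
  - exact: measurableD.
  - exact: powR_ge0.
  - by move=> x [Ex _]; exact: bound.
  rewrite /C2 -(mulrA _ A).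
  apply: (@integral_power_log _ _ _ mu _ (mrho y) _ _ eta) => //.
  - exact: measurableD.
  - by rewrite mulr_ge0// ltW.
  - by apply: HA => //; [exact: measurableD|move=> x [[]]].
  - move=> x [[[Ox _] _] /= /negP]; rewrite -leNgt => ->/=.
    by rewrite (lt_le_trans _ DJ)// OD.
rewrite -EFinD lee_fin -mulrDr mulrC ler_wpM2r ?powR_ge0//.
rewrite mulrDl lerD//; first by rewrite ler_wpM2r ?ler_norm// ltW.
by rewrite mulrAC.
Qed.

Lemma strip_kernel_integral_a : gamma > s - 2^-1 ->
  exists2 C, 0 <= C & forall eta y, 0 < eta -> Omega y ->
  (\int[mu]_(x in bd_strip Omega eta) (strip_kernel (2 * s - gamma - 1) x y)%:E <=
    (C * eta * delta y `^ gamma)%:E)%E.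
Proof.
move=> gs; have bm : m%:R < b by rewrite /b -natr1; lra.
pose p := 2 * s - gamma - 1; rewrite -/p.
(* The weight exponent [p] is the one for which [e = b - m], so that powers of [delta x] can be
   traded for the excess of the singularity. *)
pose e := gamma - p.
have eE : e = b - m%:R by rewrite /e /p /b -natr1; ring.
have e0 : 0 < e by rewrite eE subr_gt0.
have [A A0 HA] := strip_growth.
pose C1 : R := 2 ^+ m / (1 - 2 `^ (m%:R - b)) * A.
pose C2 : R := (2 : R) `^ m%:R * 2 ^+ m.+1 / (1 - (2 : R) `^ (- 1)) * 2 ^+ m.+1.
pose b' := m.+1%:R - 2 * s.
have b'0 : 0 <= b' by rewrite subr_ge0.
pose C3 := 2 `^ b' * 2 ^+ m.+1 / (1 - 2 `^ (b' - m.+1%:R)) * 2 ^+ m.+1 : R.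
exists (`|C1| + (2 `^ e * `|C2| + 2 `^ `|p| * `|C3| * 2)).
  by rewrite !addr_ge0// !mulr_ge0// powR_ge0.
move=> eta y eta0 Oy; have d0 := bdist_gt0 bO oO Oy; rewrite integral_off_diag.
set E := _ `&` _; have mE : measurable E by exact: mstrip_gt.
have mlt : measurable [set x | enorm (x - y) < eta] by exact: measurable_lt_fun.
have mle : measurable [set x | 2 * enorm (x - y) < delta x].
  rewrite (_ : [set x | _] = [set x | 0 < delta x - 2 * enorm (x - y)]).
    apply: measurable_gt_fun; apply: measurable_funB; first exact: measurable_bdist.
    by apply: measurable_funM => //; exact: measurable_cst.
  by apply/seteqP; split => x /=; rewrite subr_gt0.
have msk : measurable_fun setT (fun x => (strip_kernel p x y)%:E).
  by apply/measurable_EFinP; exact: measurable_strip_kernel1.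
have sk0 x : (0 <= (strip_kernel p x y)%:E)%E by rewrite lee_fin strip_kernel_ge0.
rewrite (@ge0_integral_setID _ _ _ _ _ [set x | enorm (x - y) < eta])//.
rewrite (@ge0_integral_setID _ _ _ _ (_ `&` _) [set x | 2 * enorm (x - y) < delta x])//;
  last exact: measurableI.
have bound x : E x -> strip_kernel p x y <=
    delta y `^ gamma * delta x `^ e * enorm (x - y) `^ (- b).
  by move=> [[Ox _] /= xy]; apply: strip_kernel_le_far => //; exact: rho_neq.
(* Away from [y], [delta x < eta] bounds the boundary factor by [eta ^ e], which cancels the
   [eta ^ (m - b)] from the outward shells. *)
have far : (\int[mu]_(x in E `\` [set x | (enorm (x - y) < eta)%R])
    (strip_kernel p x y)%:E <= (C1 * eta * delta y `^ gamma)%:E)%E.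
  rewrite (_ : C1 * eta * delta y `^ gamma = (delta y `^ gamma * eta `^ e) *
    (2 ^+ m / (1 - 2 `^ (m%:R - b)) * (A * eta) * eta `^ (m%:R - b))); last first.
    have : eta `^ e * eta `^ (m%:R - b) = 1.
      by rewrite -powRD_gt0// eE addrC subrKA subrr powRr0.
    rewrite /C1; move: (2 `^ _) (eta `^ (m%:R - b)) => q1 q2 H.
    by rewrite -[LHS]mulr1 -H; ring.
  apply: (@integral_le_power y (- b)) => //.
  - exact: measurableD.
  - by rewrite mulr_ge0// powR_ge0.
  - move=> x [Ex _]; rewrite (le_trans (bound _ Ex))//.
    rewrite ler_wpM2r ?powR_ge0// ler_wpM2l ?powR_ge0//.
    by case: Ex => -[Ox /= xe] _; apply: powR_le_base; rewrite ?bdist_ge0// ltW.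
  apply: integral_power_far => //.
  - exact: measurableD.
  - by rewrite mulr_ge0// ltW.
  - by apply: HA => //; [exact: measurableD|move=> x [[]]].
  - by move=> x [_ /= /negP]; rewrite -leNgt.
(* Here [delta x <= 2 * |x - y|] turns [delta x ^ e] times the singularity of order [b] into one of
   order [m]. *)
have near1 : (\int[mu]_(x in (E `&` [set x | (enorm (x - y) < eta)%R])
      `\` [set x | (2 * enorm (x - y) < delta x)%R])
    (strip_kernel p x y)%:E <= (2 `^ e * C2 * eta * delta y `^ gamma)%:E)%E.
  rewrite (_ : _ * delta y `^ gamma = (delta y `^ gamma * 2 `^ e) * (C2 * eta)); last ring.
  apply: (@integral_le_power y (- m%:R)) => //.
  - by apply: measurableD => //; exact: measurableI.
  - by rewrite mulr_ge0// powR_ge0.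
  - move=> x [[Ex _] /= /negP]; rewrite -leNgt => ur.
    rewrite (le_trans (bound _ Ex))//.
    rewrite -!(mulrA (delta y `^ gamma)) ler_wpM2l ?powR_ge0//.
    case: Ex => -[Ox _] /= xy.
    rewrite (_ : - m%:R = e + - b); last by rewrite eE; ring.
    rewrite powRD_gt0// mulrA ler_wpM2r ?powR_ge0// -powRM ?(ltW xy)//.
    by apply: powR_le_base; rewrite ?bdist_ge0// ltW.
  apply: integral_near_critical => //.
    by apply: measurableD => //; exact: measurableI.
  by move=> x [[[_ /= ->] /= ->] _].
(* Here the other branch of the minimum is used on a ball of radius [delta y]. The integral is of
   order [delta y ^ (2 * s - p) = delta y ^ (1 + gamma)], and one factor [delta y] is below
   [2 * eta]; otherwise the region is empty. *)
have near2 : (\int[mu]_(x in (E `&` [set x | (enorm (x - y) < eta)%R])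
      `&` [set x | (2 * enorm (x - y) < delta x)%R])
    (strip_kernel p x y)%:E <= (2 `^ `|p| * `|C3| * 2 * eta * delta y `^ gamma)%:E)%E.
  set F := _ `&` [set x | 2 * _ < _].
  have comparable x : F x -> [/\ delta y / 2 <= delta x, delta x <= 2 * delta y,
      enorm (x - y) < delta y & delta y < 2 * eta].
    move=> [[[[Ox /= xe] _] _] /= H].
    have := bdist_lipschitz bO x y; have := bdist_lipschitz bO y x.
    rewrite (enormB y x) => *; split; lra.
  have [de|ed] := ltrP (delta y) (2 * eta); last first.
    rewrite (_ : F = set0) ?integral_set0 ?lee_fin.
      by rewrite !mulr_ge0 ?powR_ge0// ltW.
    by apply/seteqP; split => // x /comparable[_ _ _]; rewrite ltNge ed.
  apply: (@le_trans _ _ ((2 `^ `|p| * delta y `^ (- p)) *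
      (C3 * delta y `^ (2 * s)))%:E).
    apply: (@integral_le_power y (- b')) => //.
    - by apply: measurableI => //; exact: measurableI.
    - by rewrite mulr_ge0// powR_ge0.
    - move=> x Fx; rewrite /strip_kernel mulrC.
      apply: ler_pM; rewrite ?invr_ge0 ?powR_ge0 ?green_profile_ge0//; last first.
        exact: green_profile_le_near.
      rewrite -powRN; have [? ? _ _] := comparable _ Fx.
      (* Since [p] may have either sign, the lower or the upper comparison of [delta x] with
         [delta y] is used, at the cost of [2 ^ |p|]. *)
      have [p0|p0] := lerP 0 p.
        apply: (@le_trans _ _ ((delta y / 2) `^ (- p))).
          by apply: powRN_le_base => //; rewrite divr_gt0.
        rewrite powRM ?invr_ge0// ?(ltW d0)// mulrC ger0_norm//.
        by rewrite -powR_inv1// -powRrM mulrNN mul1r.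
      rewrite ltr0_norm// -powRM ?(ltW d0)//; apply: powR_le_base => //.
      by rewrite oppr_ge0 ltW.
      by rewrite bdist_ge0.
    have := @integral_power_near _ _ _ mu _ (mrho y) F (2 ^+ m.+1) (delta y) b' m.+1.
    rewrite -/C3 (_ : m.+1%:R - b' = 2 * s); last by rewrite /b'; ring.
    apply => //.
    - by apply: measurableI => //; exact: measurableI.
    - by apply: ball_growth; apply: measurableI => //; exact: measurableI.
    - by rewrite /b'; have := s0; lra.
    - by move=> x /[dup] /comparable[_ _ -> _] [[[_ /= ->]]].
  rewrite lee_fin (_ : _ * _ = 2 `^ `|p| * C3 * delta y * delta y `^ gamma); last first.
    rewrite -(mulrA _ (delta y)).
    have -> : delta y * delta y `^ gamma = delta y `^ (- p) * delta y `^ (2 * s).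
      by rewrite -powR_1D// -powRD_gt0//; congr powR; rewrite /p; ring.
    exact: mulrACA.
  rewrite ler_wpM2r ?powR_ge0// -(mulrA _ C3) -(mulrA _ 2) -(mulrA _ `|C3|).
  rewrite ler_wpM2l ?powR_ge0//.
  apply: (@le_trans _ _ (`|C3| * delta y)); first by rewrite ler_wpM2r ?ler_norm// ltW.
  by rewrite ler_wpM2l// ltW.
rewrite addeC; apply: le_trans (leeD far (leeD near2 near1)) _.
rewrite -!EFinD lee_fin -!mulrDl ler_wpM2r ?powR_ge0// ler_wpM2r ?(ltW eta0)//.
rewrite lerD ?ler_norm// addrC lerD// ler_wpM2l ?powR_ge0 ?ler_norm//.
Qed.

(** A thin strip stays at distance at least [delta y / 2] from [y], so there the kernel is bounded
    by a multiple of [eta ^ (gamma - p)] and the strip has measure of order [eta]. The constant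
    depends on [y], which is enough for pointwise convergence. *)
Lemma strip_kernel_integral_interior p y : p <= gamma -> Omega y ->
  exists2 C, 0 <= C & forall eta, 0 < eta -> eta <= delta y / 2 ->
  (\int[mu]_(x in bd_strip Omega eta) (strip_kernel p x y)%:E <=
    (C * eta `^ (gamma - p) * eta)%:E)%E.
Proof.
move=> pg Oy; have d0 := bdist_gt0 bO oO Oy.
have [A A0 HA] := strip_growth; have [D D0 OD] := diameter.
exists (delta y `^ gamma * (delta y / 2) `^ (- b) * (A * D ^+ m)).
  by rewrite !mulr_ge0 ?powR_ge0// exprn_ge0// ltW.
move=> eta eta0 ed; have mS := measurable_bd_strip eta.
rewrite (_ : _ * eta = (delta y `^ gamma * eta `^ (gamma - p) * (delta y / 2) `^ (- b)) *
  (A * eta * D ^+ m)); last ring.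
apply: (@ge0_integral_le_scale _ _ _ mu (bd_strip Omega eta)
  (strip_kernel p ^~ y) (cst 1)) => //.
- by rewrite !mulr_ge0 ?powR_ge0.
- move=> x [Ox /= xe]; rewrite strip_kernel_ge0 mulr1/=.
  have xy : delta y / 2 <= enorm (x - y).
    by have := bdist_lipschitz bO y x; rewrite (enormB y x); lra.
  have d2 : 0 < delta y / 2 by rewrite divr_gt0.
  have /(strip_kernel_le_far p Ox)/le_trans : x != y by apply: rho_neq; lra.
  apply; apply: ler_pM; rewrite ?mulr_ge0 ?powR_ge0//.
    rewrite ler_wpM2l ?powR_ge0//; apply: powR_le_base; rewrite ?subr_ge0 ?bdist_ge0//.
    exact: ltW.
  exact: powRN_le_base.
rewrite (@integral_cst _ _ _ mu _ mS 1%:E) mul1e (_ : bd_strip Omega eta =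
  bd_strip Omega eta `&` [set x | enorm (x - y) < D]); first exact: HA.
by apply/esym/setIidl => x [Ox _]; exact: OD.
Qed.

End kernel.

(** * Integrals of non-measurable functions, Tonelli and dominated convergence *)

Section nonmeasurable.
Context d {T : measurableType d} {R : realType}.
Variable nu : {measure set T -> \bar R}.
Local Open Scope ereal_scope.

(** The majorant is raised to [+oo] on a measurable null set containing the exceptional points. The
    comparison then holds at every point of [D], and the integral of the majorant is unchanged. *)
Lemma ae_le_integral (D : set T) (f g : T -> \bar R) :
  measurable D -> (forall x, D x -> 0 <= f x) -> (forall x, 0 <= g x) ->
  measurable_fun setT g -> {ae nu, forall x, D x -> f x <= g x} ->
  \int[nu]_(x in D) f x <= \int[nu]_(x in D) g x.
Proof.
move=> mD f0 g0 mg [N [mN N0 NP]].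
pose h x := g x + +oo * (\1_N x)%:E.
have mh : measurable_fun setT h.
  apply: emeasurable_funD => //; apply: emeasurable_funM => //.
  by apply/measurable_EFinP; exact: measurable_indic.
have h0 x : 0 <= h x by rewrite adde_ge0// mule_ge0// lee_fin indicE.
apply: (@le_trans _ _ (\int[nu]_(x in D) h x)).
  apply: ge0_le_integral_nonmeasurable => // x Dx; rewrite /h indicE.
  have [xN|xN] := boolP (x \in N).
    by rewrite mule1 addey ?leey// gt_eqF// (lt_le_trans _ (g0 x)).
  rewrite mule0 adde0; apply: contrapT => H; move/negP: xN; apply; rewrite inE.
  by apply: NP => /= /(_ Dx).
rewrite le_eqVlt; apply/orP; left; apply/eqP; apply: ge0_ae_eq_integral => //.
- exact: measurable_funS mh.
- exact: measurable_funS mg.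
- exists N; split => // x /= H; apply: contrapT => xN; apply: H => _.
  by rewrite /h indicE memNset//= mule0 adde0.
Qed.

(** Dually, the minorant is set to zero on the null set. *)
Lemma ae_ge_integral (D : set T) (f g : T -> \bar R) :
  measurable D -> (forall x, D x -> 0 <= f x) -> (forall x, 0 <= g x) ->
  measurable_fun setT g -> {ae nu, forall x, D x -> g x <= f x} ->
  \int[nu]_(x in D) g x <= \int[nu]_(x in D) f x.
Proof.
move=> mD f0 g0 mg [N [mN N0 NP]].
pose h x := g x * (\1_(~` N) x)%:E.
have mh : measurable_fun setT h.
  apply: emeasurable_funM => //; apply/measurable_EFinP.
  by apply: measurable_indic; exact: measurableC.
have h0 x : 0 <= h x by rewrite mule_ge0// lee_fin indicE.
apply: (@le_trans _ _ (\int[nu]_(x in D) h x)).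
  rewrite le_eqVlt; apply/orP; left; apply/eqP; apply: ge0_ae_eq_integral => //.
  - exact: measurable_funS mg.
  - exact: measurable_funS mh.
  - exists N; split => // x /= H; apply: contrapT => xN; apply: H => _.
    by rewrite /h indicE mem_set//= mule1.
apply: ge0_le_integral_nonmeasurable => // x Dx; rewrite /h indicE.
have [xN|xN] := pselect (N x).
  by rewrite memNset ?mule0 ?f0//= => /(_ xN).
rewrite mem_set//= mule1; apply: contrapT => H; apply: xN.
by apply: NP => /= /(_ Dx).
Qed.

(** The integrals of the positive and the negative part are both nonnegative and at most the right
    side, hence so is the absolute value of their difference; if either is infinite, so is the right
    side. *)
Lemma abse_integral_le (D : set T) (f : T -> \bar R) :
  `|\int[nu]_(x in D) f x| <= \int[nu]_(x in D) `|f x|.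
Proof.
have sub (a b c : \bar R) : 0 <= a -> 0 <= b -> a <= c -> b <= c -> `|a - b| <= c.
  move=> a0 b0 ac bc; rewrite /abse; move: a b c a0 b0 ac bc.
  move=> [a| |] [b| |] [c| |]; rewrite ?lee_fin ?leey//= => *.
  by rewrite ler_norml; lra.
rewrite integralE; apply: sub.
- by apply: integral_ge0 => x _; exact: funepos_ge0.
- by apply: integral_ge0 => x _; exact: funeneg_ge0.
- apply: ge0_le_integral_nonmeasurable => x _; first exact: funepos_ge0.
  by rewrite funeposE ge_max lee_abs abse_ge0.
- apply: ge0_le_integral_nonmeasurable => x _; first exact: funeneg_ge0.
  by rewrite funenegE ge_max abse_ge0 andbT -abseN lee_abs.
Qed.

End nonmeasurable.

Lemma point_negligible {R : realType} m (x : 'rV[R]_m.+1) :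
  (@rV_lebesgue R m.+1).-negligible [set x].
Proof.
exists [set y : 'rV[R]_m.+1 | forall i, `|x ord0 i - y ord0 i| <= 0]; split.
- exact: measurable_cube.
- by rewrite rV_lebesgue_cube// mulr0 expr0n.
- by move=> _ -> /= i; rewrite subrr normr0.
Qed.

Section assembly.
Context {R : realType} (m : nat) (Omega : set 'rV[R]_m.+1) (s gamma : R).
Local Notation mu := (@rV_lebesgue R m.+1).
Local Notation delta := (bdist Omega).
Hypothesis O_dom : bounded_C11_domain Omega.
Hypotheses (s01 : 0 < s <= 1) (gamma01 : 0 < gamma <= 1) (s_le : 2 * s <= m.+1%:R).
Variable h : 'rV[R]_m.+1 -> R.
Hypotheses (mh : measurable_fun setT h) (h0 : forall y, 0 <= h y).

Local Notation K := (strip_kernel Omega s gamma).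
Local Open Scope ereal_scope.

Let oO : open Omega. Proof. by case: O_dom. Qed.
Let mO : measurable Omega. Proof. exact: open_measurable_rV. Qed.
Let bO : boundary Omega !=set0. Proof. exact: domain_boundary_nonempty. Qed.

(** The function [K_eta] of the overview, with the Green kernel replaced by its profile. *)
Definition strip_weight (p eta : R) (y : 'rV[R]_m.+1) : \bar R :=
  \int[mu]_(x in bd_strip Omega eta) (K p x y)%:E.

Lemma strip_weight_ge0 p eta y : 0 <= strip_weight p eta y.
Proof. by apply: integral_ge0 => x _; rewrite lee_fin strip_kernel_ge0. Qed.

Let mK p : measurable_fun setT (fun z : 'rV[R]_m.+1 * 'rV[R]_m.+1 => K p z.1 z.2).
Proof. exact: measurable_strip_kernel. Qed.

Let mstrip eta : measurable (bd_strip Omega eta).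
Proof. exact: measurable_bd_strip. Qed.

Let Phi p eta (z : 'rV[R]_m.+1 * 'rV[R]_m.+1) : \bar R :=
  (\1_(bd_strip Omega eta) z.1 * K p z.1 z.2)%:E.

Let mPhi p eta : measurable_fun setT (Phi p eta).
Proof.
apply/measurable_EFinP/measurable_funM; last exact: mK.
have mi : measurable_fun setT (\1_(bd_strip Omega eta) : 'rV[R]_m.+1 -> R).
  exact: measurable_indic.
exact (measurableT_comp mi measurable_fst).
Qed.

Let Phi0 p eta z : 0 <= Phi p eta z.
Proof. by rewrite lee_fin mulr_ge0 ?strip_kernel_ge0// indicE. Qed.

Let integral_indicM (D : set 'rV[R]_m.+1) (g : 'rV[R]_m.+1 -> R) :
  \int[mu]_(x in D) (g x)%:E = \int[mu]_x (\1_D x * g x)%:E.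
Proof.
rewrite integral_mkcond; apply: eq_integral => x _; rewrite /patch indicE.
by case: ifPn => _; rewrite ?mul1r ?mul0r.
Qed.

Let strip_weightE p eta : strip_weight p eta = fubini_G mu (Phi p eta).
Proof.
by apply/funext => y; rewrite /strip_weight integral_indicM.
Qed.

Lemma measurable_strip_weight p eta : measurable_fun setT (strip_weight p eta).
Proof.
rewrite strip_weightE.
exact: (@measurable_fun_fubini_tonelli_G _ _ _ _ _ mu (Phi p eta)).
Qed.

Lemma strip_integral_tonelli p eta :
  \int[mu]_(x in bd_strip Omega eta)
    ((\int[mu]_(y in Omega) (green_profile Omega s gamma x y * h y)%:E) *
      ((delta x `^ p)^-1)%:E) =
  \int[mu]_(y in Omega) ((h y)%:E * strip_weight p eta y).
Proof.
(* Both domains of integration enter as indicators, so that Tonelli applies on the whole product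
   space. *)
pose Psi (z : 'rV[R]_m.+1 * 'rV[R]_m.+1) : \bar R :=
  ((\1_(bd_strip Omega eta) z.1 * K p z.1 z.2) * (\1_Omega z.2 * h z.2))%:E.
have mPsi : measurable_fun setT Psi.
  apply/measurable_EFinP/measurable_funM.
    by have /measurable_EFinP := mPhi p eta.
  apply: measurable_funM.
    have mi : measurable_fun setT (\1_Omega : 'rV[R]_m.+1 -> R).
      exact: measurable_indic.
    exact (measurableT_comp mi measurable_snd).
  exact (measurableT_comp mh measurable_snd).
have Psi0 z : 0 <= Psi z.
  rewrite lee_fin; apply: mulr_ge0; last by rewrite mulr_ge0.
  by rewrite mulr_ge0 ?strip_kernel_ge0.
have hk0 x y : (0 <= green_profile Omega s gamma x y * h y)%R.
  by rewrite mulr_ge0// green_profile_ge0.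
transitivity (\int[mu]_x \int[mu]_y Psi (x, y)).
  rewrite integral_mkcond; apply: eq_integral => x _.
  rewrite /patch; case: ifPn => xs; last first.
    rewrite integral0_eq// => y _; rewrite /Psi/= indicE (negbTE xs).
    by rewrite !mul0r.
  rewrite -ge0_integralZr//; last 3 first.
  - apply/measurable_EFinP; apply: (measurable_funS measurableT) => //.
    apply: measurable_funM => //.
    have H : measurable_fun setT (fun z : 'rV[R]_m.+1 * 'rV[R]_m.+1 =>
        green_profile Omega s gamma z.1 z.2) by exact: measurable_green_profile.
    exact (measurableT_comp H (measurable_pair1 x)).
  - by move=> y _; rewrite lee_fin.
  - by rewrite lee_fin invr_ge0 powR_ge0.
  under eq_integral do rewrite -EFinM.
  rewrite integral_indicM; apply: eq_integral => y _.
  rewrite /Psi/= [\1_(bd_strip Omega eta) x]indicE xs mul1r /strip_kernel.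
  by congr EFin; rewrite mulrCA [LHS]mulrACA [RHS]mulrACA (mulrC (h y)).
rewrite (fubini_tonelli (m1 := mu) (m2 := mu) Psi)//.
rewrite [RHS]integral_mkcond; apply: eq_integral => y _.
rewrite /patch; case: ifPn => yO; last first.
  rewrite integral0_eq// => x _; rewrite /Psi/= [\1_Omega y]indicE (negbTE yO).
  by rewrite mul0r mulr0.
have Phi_y : measurable_fun setT (fun x => Phi p eta (x, y)).
  exact (measurableT_comp (mPhi p eta) (measurable_pair2 y)).
rewrite strip_weightE /fubini_G -ge0_integralZl//; last by rewrite lee_fin.
apply: eq_integral => x _; rewrite /Psi/Phi/= [\1_Omega y]indicE yO mul1r -EFinM.
by rewrite mulrC.
Qed.

Hypothesis hL1 : \int[mu]_(y in Omega) (h y * delta y `^ gamma)%:E < +oo.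

Let mhd : measurable_fun setT (fun y => (h y * delta y `^ gamma)%R).
Proof.
apply: measurable_funM => //.
exact (measurableT_comp (measurable_powR gamma) (measurable_bdist bO)).
Qed.

Let hd0 y : (0 <= h y * delta y `^ gamma)%R.
Proof. by rewrite mulr_ge0// powR_ge0. Qed.

Lemma integral_strip_weight_le p eta (C : R) : (0 <= C)%R ->
  (forall y, Omega y -> strip_weight p eta y <= (C * delta y `^ gamma)%:E) ->
  \int[mu]_(y in Omega) ((h y)%:E * strip_weight p eta y) <=
  C%:E * \int[mu]_(y in Omega) (h y * delta y `^ gamma)%:E.
Proof.
move=> C0 HC; rewrite -ge0_integralZl//.
- apply: ge0_le_integral_nonmeasurable => y Oy.
    by rewrite mule_ge0 ?lee_fin ?strip_weight_ge0.
  apply: le_trans (_ : (h y)%:E * (C * delta y `^ gamma)%:E <= _).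
    by rewrite lee_wpmul2l ?lee_fin// HC.
  by rewrite -!EFinM lee_fin mulrCA.
- by apply/measurable_EFinP; exact: measurable_funS mhd.
- by move=> y _; rewrite lee_fin.
Qed.

(** The right limit is tested along positive sequences tending to 0, shifted so that all terms are
    below [eta0]. Dominated convergence applies with the integrable majorant
    [C * h * delta ^ gamma]. *)
Lemma integral_strip_weight_cvg p (N : R -> R) (eta0 C : R) :
  (0 < eta0)%R -> (0 <= C)%R ->
  (forall eta, (0 < eta < eta0)%R -> (0 < N eta)%R) ->
  (forall eta y, (0 < eta < eta0)%R -> Omega y ->
     strip_weight p eta y <= (C * N eta * delta y `^ gamma)%:E) ->
  (forall y, Omega y ->
    ((N eta)^-1)%:E * strip_weight p eta y @[eta --> (0%R : R)^'+] --> 0) ->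
  ((N eta)^-1)%:E * \int[mu]_(y in Omega) ((h y)%:E * strip_weight p eta y)
    @[eta --> (0%R : R)^'+] --> 0.
Proof.
move=> eta0_gt0 C0 N0 HC Hcvg; apply/cvge_at_rightP => u [u0 ucvg].
have [n0 un0] : exists n0, forall n, (0 < u (n + n0)%N < eta0)%R.
  have [n0 _ Hn] : \forall n \near \oo, (u n < eta0)%R.
    by apply: cvgr_lt ucvg _ eta0_gt0.
  by exists n0 => n; rewrite u0 Hn//= leq_addl.
rewrite -(cvg_shiftn n0)/=.
pose g n y := (h y)%:E * (((N (u (n + n0)%N))^-1)%:E * strip_weight p (u (n + n0)%N) y).
have Nu n : (0 <= (N (u (n + n0)%N))^-1)%R by rewrite invr_ge0 ltW// N0.
have -> : (fun n => ((N (u (n + n0)%N))^-1)%:E *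
    \int[mu]_(y in Omega) ((h y)%:E * strip_weight p (u (n + n0)%N) y)) =
    (fun n => \int[mu]_(y in Omega) g n y).
  apply/funext => n; rewrite -ge0_integralZl//.
  - by apply: eq_integral => y _; rewrite /g muleCA.
  - apply: emeasurable_funM; first by apply/measurable_EFinP; exact: measurable_funS mh.
    by apply: measurable_funS (measurable_strip_weight _ _).
  - by move=> y _; rewrite mule_ge0 ?lee_fin ?strip_weight_ge0.
  - by rewrite lee_fin.
have := @dominated_cvg _ _ _ mu Omega mO g (cst 0)
  (fun y => (C * (h y * delta y `^ gamma))%:E).
rewrite integral0; apply => //.
- move=> n; apply: emeasurable_funM.
    by apply/measurable_EFinP; exact: measurable_funS mh.
  apply: emeasurable_funM; first exact: measurable_cst.
  by apply: measurable_funS (measurable_strip_weight _ _).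
- move=> y Oy; rewrite /g /=.
  have H : ((N (u (n + n0)%N))^-1)%:E * strip_weight p (u (n + n0)%N) y @[n --> \oo] --> 0.
    have /cvge_at_rightP/(_ u (conj u0 ucvg)) := Hcvg y Oy.
    by rewrite -(cvg_shiftn n0).
  rewrite -[X in _ --> X](mule0 (h y)%:E); exact: cvgeZl H.
- apply/integrableP; split.
    apply/measurable_EFinP; apply: measurable_funM; first exact: measurable_cst.
    exact: measurable_funS mhd.
  under eq_integral do rewrite gee0_abs ?lee_fin ?mulr_ge0 ?powR_ge0// EFinM.
  rewrite ge0_integralZl//.
  + by rewrite lte_mul_pinfty// lee_fin.
  + by apply/measurable_EFinP; exact: measurable_funS mhd.
  + by move=> y _; rewrite lee_fin.
- move=> n y Oy; rewrite gee0_abs ?mule_ge0 ?lee_fin ?strip_weight_ge0//.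
  apply: le_trans (_ : (h y)%:E * (C * delta y `^ gamma)%:E <= _).
    rewrite lee_wpmul2l ?lee_fin//.
    apply: le_trans (lee_wpmul2l _ (HC _ y (un0 n) Oy)) _; first by rewrite lee_fin.
    rewrite -EFinM lee_fin mulrA mulrCA mulVf ?mulr1//.
    by rewrite gt_eqF// N0.
  by rewrite -EFinM lee_fin mulrCA.
Qed.

End assembly.

(** * Borel majorant for the Green operator *)

Section green_bound.
Context {R : realType} (m : nat) (Omega : set 'rV[R]_m.+1) (s gamma : R).
Local Notation mu := (@rV_lebesgue R m.+1).
Local Notation delta := (bdist Omega).
Local Open Scope ereal_scope.

(** The majorant is [C0 * |g|], where [g] is a Borel version of [f] and [C0] is the comparison
    constant of the kernel. For fixed [x] the comparison fails at most on [y = x] and where [f] and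
    [g] differ, both null. *)
Lemma strip_integral_green_op_le (G : 'rV[R]_m.+1 -> 'rV[R]_m.+1 -> R)
    (f : 'rV[R]_m.+1 -> R) :
  bounded_C11_domain Omega -> green_kernel Omega s gamma G ->
  weighted_L1 Omega gamma f ->
  exists h : 'rV[R]_m.+1 -> R, [/\ measurable_fun setT h, forall y, (0 <= h y)%R,
    \int[mu]_(y in Omega) (h y * delta y `^ gamma)%:E < +oo &
    forall p eta, strip_integral Omega p (green_op Omega G f) eta <=
      \int[mu]_(y in Omega) ((h y)%:E * strip_weight Omega s gamma p eta y)].
Proof.
move=> O_dom [s01 gamma01 s_le [_ _ [C0 C0_gt0 GC]]] [[g [mg fg]] fL1].
have oO : open Omega by case: O_dom.
have mO : measurable Omega by exact: open_measurable_rV.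
have bO : boundary Omega !=set0 by exact: domain_boundary_nonempty.
have mag : measurable_fun setT (fun y => `|g y|%R).
  exact: (measurableT_comp (@normr_measurable R setT)).
pose h y := (C0 * `|g y|)%R.
have mh : measurable_fun setT h.
  by apply: measurable_funM => //; exact: measurable_cst.
have h0 y : (0 <= h y)%R by rewrite mulr_ge0// ltW.
exists h; split => // [|p eta].
  have md : measurable_fun setT (fun y => (delta y `^ gamma)%R).
    exact (measurableT_comp (measurable_powR gamma) (measurable_bdist bO)).
  have mgd : measurable_fun setT (fun y => (`|g y| * delta y `^ gamma)%:E).
    by apply/measurable_EFinP; exact: measurable_funM.
  have gd0 y : 0 <= (`|g y| * delta y `^ gamma)%:E.
    by rewrite lee_fin mulr_ge0// powR_ge0.
  under eq_integral do rewrite /h -mulrA EFinM.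
  rewrite ge0_integralZl//; last 2 first.
  - exact: measurable_funS mgd.
  - by rewrite lee_fin ltW.
  apply: lte_mul_pinfty => //; first by rewrite lee_fin ltW.
  apply: le_lt_trans fL1; apply: ae_ge_integral => //.
  apply: filterS fg => y H Oy; rewrite lee_fin -H// normrM ler_wpM2l//.
  exact: ler_norm.
rewrite -strip_integral_tonelli//; apply: ge0_le_integral_nonmeasurable => x [Ox _].
  by rewrite mule_ge0// lee_fin invr_ge0 powR_ge0.
rewrite lee_wpmul2r ?lee_fin ?invr_ge0 ?powR_ge0//.
apply: le_trans (abse_integral_le _ _ _) _; apply: ae_le_integral => //.
- by move=> y; rewrite lee_fin mulr_ge0// green_profile_ge0.
- apply/measurable_EFinP; apply: measurable_funM => //.
  have H : measurable_fun setT (fun z : 'rV[R]_m.+1 * 'rV[R]_m.+1 =>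
      green_profile Omega s gamma z.1 z.2) by exact: measurable_green_profile.
  exact (measurableT_comp H (measurable_pair1 x)).
have xneq : {ae mu, forall y, x != y}.
  apply: negligibleS (point_negligible x) => y /= /negP/negPn/eqP; by [].
apply: filterS2 fg xneq => y fgy xy Oy.
rewrite lee_fin normrM fgy// /h mulrA ler_wpM2r//.
have /= /andP[Gl Gu] := GC (x, y) (And3 Ox Oy xy).
(* The lower comparison makes [G x y] nonnegative, so the upper one bounds its absolute value. *)
rewrite mulrC ger0_norm// (le_trans _ Gl)// mulr_ge0 ?invr_ge0 ?(ltW C0_gt0)//.
exact: green_profile_ge0.
Qed.

End green_bound.

(** * Right limits at zero *)

Section right_limits.
Context {R : realType}.

Lemma squeeze_cvge0_right (F : R -> \bar R) (r : R -> R) (e0 : R) : 0 < e0 ->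
  (forall eta, 0 < eta < e0 -> (0%:E <= F eta <= (r eta)%:E)%E) ->
  r eta @[eta --> 0^'+] --> 0 -> (F eta @[eta --> (0 : R)^'+] --> 0%E)%classic.
Proof.
move=> e0_gt0 Fr r0.
apply: (@squeeze_cvge _ _ _ _ (cst 0%E) F (EFin \o r)).
- near=> eta; apply: Fr; apply/andP; split; first by near: eta; exact: nbhs_right_gt.
  by near: eta; exact: nbhs_right_lt.
- exact: cvg_cst.
- by apply: cvg_EFin => //; exact: nearW.
Unshelve. all: by end_near. Qed.

Lemma inv_ln_cvg0 : (`|ln eta|^-1 : R) @[eta --> (0 : R)^'+] --> (0 : R).
Proof.
apply/cvgrPdist_le => e e0; near=> eta.
have eta0 : 0 < eta by near: eta; exact: nbhs_right_gt.
have eta1 : eta < expR (- e^-1) by near: eta; apply: nbhs_right_lt; exact: expR_gt0.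
have H : ln eta < - e^-1 by rewrite -[ltRHS]expRK ltr_ln ?posrE ?expR_gt0.
have ei : 0 < e^-1 by rewrite invr_gt0.
rewrite sub0r normrN normfV normr_id ltr0_norm; last lra.
by rewrite -[leRHS]invrK lef_pV2 ?posrE//; lra.
Unshelve. all: by end_near. Qed.

End right_limits.

(** * Assembly of the cases a), b) and c) *)

Unset Implicit Arguments.

Theorem lemma3p8 (R : realType) (n : nat) (Omega : set 'rV[R]_n)
    (s gamma : R) (G : 'rV[R]_n -> 'rV[R]_n -> R) (f : 'rV[R]_n -> R)
    (n_ge1 : (1 <= n)%N) (Omega_dom : bounded_C11_domain Omega)
    (G_green : green_kernel Omega s gamma G)
    (f_L1 : weighted_L1 Omega gamma f) :
  [/\ gamma > s - 2^-1 ->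
        ((eta^-1)%:E *
          strip_integral Omega (2 * s - gamma - 1) (green_op Omega G f) eta)%E
          @[eta --> (0 : R)^'+] --> 0%E,
      gamma = s - 2^-1 ->
        (((eta * `|ln eta|)^-1)%:E *
          strip_integral Omega gamma (green_op Omega G f) eta)%E
          @[eta --> (0 : R)^'+] --> 0%E
    & gamma < s - 2^-1 ->
        exists C : R, forall eta : R, 0 < eta ->
          ((eta^-1)%:E *
            strip_integral Omega gamma (green_op Omega G f) eta <= C%:E)%E].
Proof.
case: n => [//|m] in Omega G f n_ge1 Omega_dom G_green f_L1 *.
have [h [mh h0 hL1 Hle]] := strip_integral_green_op_le Omega_dom G_green f_L1.
have [s01 gamma01 s_le _] := G_green.
have oO : open Omega by case: Omega_dom.
have bO : boundary Omega !=set0 by exact: domain_boundary_nonempty.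
have strip0 p eta : (0 <= strip_integral Omega p (green_op Omega G f) eta)%E.
  by apply: integral_ge0 => x _; rewrite mule_ge0// lee_fin invr_ge0 powR_ge0.
(* The common end of a) and b), for a normalization [N]: the bound uniform in [y] supplies the
   dominating function, and the bound for fixed [y], with a rate [r] tending to 0, supplies the
   pointwise limit. *)
have conclude p (N : R -> R) (eta0 C : R) : 0 < eta0 -> 0 <= C ->
    (forall eta, 0 < eta < eta0 -> 0 < N eta) ->
    (forall eta y, 0 < eta < eta0 -> Omega y ->
      (strip_weight Omega s gamma p eta y <= (C * N eta * bdist Omega y `^ gamma)%:E)%E) ->
    (forall y, Omega y -> exists C' e1 : R, exists r : R -> R,
      [/\ 0 < e1, r eta @[eta --> (0 : R)^'+] --> (0 : R) &
      forall eta, 0 < eta < e1 ->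
        (strip_weight Omega s gamma p eta y <= (C' * r eta * N eta)%:E)%E]) ->
    (((N eta)^-1)%:E * strip_integral Omega p (green_op Omega G f) eta)%E
      @[eta --> (0 : R)^'+] --> 0%E.
  move=> eta0_gt0 C0 N0 HC Hr.
  apply: (@squeeze_cvge _ _ _ _ (cst 0%E) _ (fun eta => ((N eta)^-1)%:E *
    \int[rV_lebesgue m.+1]_(y in Omega) ((h y)%:E * strip_weight Omega s gamma p eta y))%E).
  - near=> eta; have /N0 Neta : 0 < eta < eta0.
      by apply/andP; split; near: eta; [exact: nbhs_right_gt|exact: nbhs_right_lt].
    rewrite mule_ge0 ?lee_fin ?invr_ge0 ?(ltW Neta)//=.
    by rewrite lee_wpmul2l// lee_fin invr_ge0 ltW.
  - exact: cvg_cst.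
  - apply: (integral_strip_weight_cvg Omega_dom mh h0 hL1 eta0_gt0 C0 N0 HC) => y Oy.
    have [C' [e1 [r [e1_gt0 r0 Hw]]]] := Hr y Oy.
    apply: (@squeeze_cvge0_right _ _ (fun eta => C' * r eta) (Num.min e1 eta0)).
    + by rewrite lt_min e1_gt0.
    + move=> eta /andP[eta_gt0]; rewrite lt_min => /andP[eta1 eta2].
      have Neta : 0 < N eta by rewrite N0// eta_gt0.
      rewrite mule_ge0 ?lee_fin ?invr_ge0 ?(ltW Neta) ?strip_weight_ge0//=.
      rewrite muleC lee_pdivrMr// -EFinM Hw// eta_gt0//.
    + by rewrite -[X in _ --> X](mulr0 C'); exact: cvgMr.
split.
- move=> gs.
  have [C C0 HC] := strip_kernel_integral_a Omega_dom s01 gamma01 s_le gs.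
  apply: (conclude _ id 1 C) => //.
  + by move=> eta /andP[].
  + by move=> eta y /andP[eta0 _] Oy; exact: HC.
  move=> y Oy; set p := 2 * s - gamma - 1.
  have pg : p < gamma by rewrite /p; lra.
  have [C' C'0 HC'] := strip_kernel_integral_interior Omega_dom gamma01 s_le (ltW pg) Oy.
  exists C', (bdist Omega y / 2), (fun eta => eta `^ (gamma - p)); split.
  + by rewrite divr_gt0// bdist_gt0.
  + by apply: powR_cvg0; rewrite subr_gt0.
  + by move=> eta /andP[eta0 eta1]; apply: HC' => //; exact: ltW.
- move=> gs.
  have [C1 C10 [C2 C20 [D D0 HC]]] :=
    strip_kernel_integral_b Omega_dom gamma01 gs.
  have ln2_gt0 : 0 < ln 2 :> R by rewrite ln_gt0// ltr1n.
  pose c : R := `|ln D| / ln 2 / ln 2 + 2 / ln 2.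
  have c0 : 0 <= c by rewrite addr_ge0// !divr_ge0// ltW.
  (* Below [1/2], [|ln eta|] is at least [ln 2], so additive constants can be absorbed into
     multiples of it; the constant [c] above collects them. *)
  have lnE (eta : R) : 0 < eta < 2^-1 -> ln 2 <= `|ln eta| /\ ln eta = - `|ln eta|.
    move=> /andP[eta0 eta1].
    have H : ln eta <= - ln 2.
      by rewrite -lnV ?posrE// ler_ln ?posrE// ?invr_gt0// ltW.
    rewrite ler0_norm ?opprK; first by split; rewrite // lerNr.
    by rewrite (le_trans H)// oppr_le0 ltW.
  apply: (conclude _ (fun eta => eta * `|ln eta|) 2^-1 (C1 / ln 2 + C2 * c)).
  + by rewrite invr_gt0.
  + by rewrite addr_ge0 ?mulr_ge0// invr_ge0 ltW.
  + move=> eta /[dup] /andP[eta0 _] /lnE[? _].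
    by rewrite mulr_gt0//; lra.
  + move=> eta y /[dup] /andP[eta0 _] /lnE[]; set L := `|ln eta| => L2 lnL Oy.
    (* Enough shells to give [2 ^+ J * eta >= D], yet at most [c * L]. *)
    pose J := (Num.trunc ((`|ln D| + L) / ln 2)).+1.
    have L0 : 0 <= L by exact: normr_ge0.
    have X0 : 0 <= (`|ln D| + L) / ln 2 by rewrite divr_ge0 ?addr_ge0 ?(ltW ln2_gt0).
    have [JL JU] : (`|ln D| + L) / ln 2 <= J%:R /\ J%:R <= (`|ln D| + L) / ln 2 + 1.
      split; first by rewrite ltW// truncnS_gt.
      by rewrite /J -natr1 lerD2r truncn_le.
    have DJ : D <= 2 ^+ J * eta.
      rewrite -ler_ln ?posrE ?mulr_gt0 ?exprn_gt0//.
      rewrite lnM ?posrE ?exprn_gt0// lnXn// lnL.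
      have : `|ln D| + L <= J%:R * ln 2 by rewrite -ler_pdivrMr.
      rewrite mulr_natl; have := ler_norm (ln D); lra.
    apply: le_trans (HC J eta y eta0 Oy DJ) _.
    rewrite lee_fin ler_wpM2r ?powR_ge0// (mulrC eta) mulrA ler_wpM2r ?(ltW eta0)//.
    have L1 : 1 <= L / ln 2 by rewrite ler_pdivlMr// mul1r.
    rewrite mulrDl lerD//.
      by rewrite -mulrA -[leLHS]mulr1 ler_wpM2l// mulrC.
    rewrite -mulrA ler_wpM2l// (le_trans JU)//.
    have aL : `|ln D| / ln 2 <= `|ln D| / ln 2 * (L / ln 2).
      by rewrite ler_peMr// divr_ge0// ltW.
    have -> : c * L = `|ln D| / ln 2 * (L / ln 2) + 2 * (L / ln 2).
      by rewrite /c; ring.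
    by rewrite mulrDl -addrA lerD// mulr_natl mulr2n lerD2l.
  move=> y Oy.
  have [C' C'0 HC'] := strip_kernel_integral_interior Omega_dom gamma01 s_le (lexx gamma) Oy.
  have d0 := bdist_gt0 bO oO Oy.
  (* For fixed [y] the weight is of order [eta], so after division by [eta * |ln eta|] the rate is
     the inverse logarithm. *)
  exists C', (Num.min (bdist Omega y / 2) 2^-1), (fun eta => `|ln eta|^-1); split.
  + by rewrite lt_min divr_gt0//= invr_gt0.
  + exact: inv_ln_cvg0.
  move=> eta /andP[eta0]; rewrite lt_min => /andP[eta1 eta2].
  apply: le_trans (HC' _ eta0 (ltW eta1)) _.
  have [|L2 _] := lnE eta; first by rewrite eta0.
  rewrite lee_fin subrr powRr0 mulr1 -mulrA ler_wpM2l//.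
  rewrite mulrCA mulVf ?mulr1//; apply: lt0r_neq0; lra.
- move=> gs.
  have [C C0 HC] := strip_kernel_integral_c Omega_dom gamma01 s_le gs.
  set I := (\int[_]_(y in Omega) _)%E in hL1.
  have I0 : (0 <= I)%E.
    by apply: integral_ge0 => y _; rewrite lee_fin mulr_ge0// powR_ge0.
  have IE : I = (fine I)%:E by rewrite fineK// ge0_fin_numE.
  exists (C * fine I) => eta eta0.
  have /(le_trans (Hle gamma eta)) : (\int[rV_lebesgue m.+1]_(y in Omega)
      ((h y)%:E * strip_weight Omega s gamma gamma eta y) <= (C * eta)%:E * I)%E.
    apply: integral_strip_weight_le => //; first by rewrite mulr_ge0// ltW.
    by move=> y Oy; exact: HC.
  rewrite IE -EFinM => Hs; rewrite muleC lee_pdivrMr// -EFinM.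
  by rewrite mulrAC.
Unshelve. all: by end_near.
Qed.
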